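(* Suppose that the utility fields $U_1,\dots,U_M$ satisfy the Assumption on utilities given in the context, that the total endowment satisfies $\Lambda>0$, that the initial allocation $(\alpha^m_0)_{m=1,\dots,M}$ of $\Lambda$ satisfies $\alpha^m_0\neq 0$ for $m=1,\dots,M$, and that $$\mathbb{E}[|U_m(t\Lambda)|]<\infty,\quad t\in(0,1],\; m=1,\dots,M.$$ Then an Arrow-Debreu equilibrium exists.
   Context: Let $M\in\{1,2,\dots\}$ (number of agents) and let $(\mathbf{S},\mathcal{S},\mu)$ be a measure space with $\sigma$-finite measure $\mu$. $\mathbf{L}^0$ is the space of ($\mu$-equivalence classes of) measurable functions on $\mathbf{S}$ with values in $[-\infty,\infty)$, and $\mathbf{L}^0_+$ is the cone of non-negative elements of $\mathbf{L}^0$. (In)equalities between measurable functions are understood $\mu$-a.e.; $\alpha\neq 0$ means that $\alpha$ is not the zero element of $\mathbf{L}^0$. For $\alpha\in\mathbf{L}^0$ write $\mathbb{E}[\alpha]=\int_{\mathbf{S}}\alpha(s)\,\mu(ds)$, with the convention $\mathbb{E}[\alpha]=-\infty$ whenever $\mathbb{E}[\min(\alpha,0)]=-\infty$. For each $m=1,\dots,M$, $U_m:[0,\infty)\to\mathbf{L}^0$ is a measurable field (for each $c$, $s\mapsto U_m(c)(s)$ is measurable). For $\alpha\in\mathbf{L}^0_+$, $U_m(\alpha)$ denotes $s\mapsto U_m(\alpha(s))(s)$. $U'_m$ is the derivative in $c$. Assumption on utilities: for every $m$ and every $s\in\mathbf{S}$ the function $c\mapsto U_m(c)(s)$ on $(0,\infty)$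 is strictly increasing, strictly concave, continuously differentiable, and satisfies the Inada conditions $\lim_{c\to\infty}U_m'(c)(s)=0$ and $\lim_{c\downarrow 0}U_m'(c)(s)=\infty$. At $c=0$, by continuity, $U_m(0)(s)=\lim_{c\downarrow 0}U_m(c)(s)$, which may be $-\infty$. $\Lambda\in\mathbf{L}^0_+$ is the total endowment. An allocation of $\Lambda$ is a family $(\alpha^m)_{m=1,\dots,M}$ of elements of $\mathbf{L}^0_+$ with $\sum_{m=1}^M\alpha^m=\Lambda$. The initial allocation $(\alpha_0^m)_{m=1,\dots,M}$ is a given allocation of $\Lambda$. An Arrow-Debreu equilibrium is a pair $(\zeta,(\alpha_1^m)_{m=1,\dots,M})$ consisting of a measurable function $\zeta>0$ (state price density) and an allocation $(\alpha^m_1)$ of $\Lambda$ (equilibrium allocation) such that $\mathbb{E}[\zeta\Lambda]<\infty$ and, for each $m=1,\dots,M$, $\mathbb{E}[|U_m(\alpha^m_1)|]<\infty$ and $\alpha_1^m$ is the maximizer of $\mathbb{E}[U_m(\alpha)]$ over all $\alpha\in\mathbf{L}^0_+$ with $\mathbb{E}[\zeta(\alpha-\alpha^m_0)]=0$. *)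

(* Defs.v *)
From HB Require Import structures.
From mathcomp Require Import all_boot all_order all_algebra.
From mathcomp Require Import all_classical all_reals all_analysis measurable_realfun.

Set Implicit Arguments.
Unset Strict Implicit.
Unset Printing Implicit Defensive.

Import Order.TTheory GRing.Theory Num.Theory.
Import numFieldNormedType.Exports.

Local Open Scope classical_set_scope.
Local Open Scope ring_scope.

(* Values in [-oo, +oo). *)
Definition L0 (R : realType) (d : measure_display) (S : measurableType d)
    (f : S -> \bar R) : Prop :=
  measurable_fun setT f /\ forall s, (f s < +oo)%E.

(* A class of a.e. nonnegative [-oo, +oo)-valued functions is given by a
   representative that is real-valued and nonnegative everywhere, so that it
   can be plugged pointwise into a field defined on [0, +oo) only.  Relations
   between such representatives are stated almost everywhere. *)
Definition L0_plus (R : realType) (d : measure_display) (S : measurableType d)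
    (f : S -> R) : Prop :=
  measurable_fun setT f /\ forall s, 0 <= f s.

(* The random field U : [0, +oo) -> L0 is a function on R whose values at
   c < 0 are unconstrained (and never used). *)
Definition measurable_field (R : realType) (d : measure_display)
    (S : measurableType d) (U : R -> S -> \bar R) : Prop :=
  forall c : R, 0 <= c -> L0 (U c).

Definition field_comp (R : realType) (d : measure_display)
    (S : measurableType d) (U : R -> S -> \bar R) (f : S -> R) : S -> \bar R :=
  fun s => U (f s) s.

Definition strictly_increasing_pos (R : realType) (u : R -> R) : Prop :=
  forall x y : R, 0 < x -> x < y -> u x < u y.

Definition strictly_concave_pos (R : realType) (u : R -> R) : Prop :=
  forall x y t : R, 0 < x -> 0 < y -> x != y -> 0 < t < 1 ->
    t * u x + (1 - t) * u y < u (t * x + (1 - t) * y).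

Definition continuously_differentiable_pos (R : realType) (u : R -> R) : Prop :=
  forall x : R, 0 < x -> derivable u x 1 /\ {for x, continuous (derive1 u)}.

Definition inada (R : realType) (u : R -> R) : Prop :=
  derive1 u x @[x --> +oo] --> 0 /\ derive1 u x @[x --> 0^'+] --> +oo.

Definition utility_assumption (R : realType) (d : measure_display)
    (S : measurableType d) (U : R -> S -> \bar R) : Prop :=
  forall s,
    let u := fun c => fine (U c s) in
    [/\ forall c : R, 0 < c -> U c s \is a fin_num,
        strictly_increasing_pos u,
        strictly_concave_pos u,
        continuously_differentiable_pos u /\ inada u &
        (* limit in \bar R, so that U 0 s = -oo is allowed *)
        U c s @[c --> 0^'+] --> U 0 s].

Definition allocation (R : realType) (d : measure_display)
    (S : measurableType d) (mu : {sigma_finite_measure set S -> \bar R})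
    (M : nat) (Lambda : S -> R) (a : 'I_M -> S -> R) : Prop :=
  (forall m, L0_plus (a m)) /\ {ae mu, forall s, \sum_(m < M) a m s = Lambda s}.

(* The integral of a measurable f is the difference of the integrals of f^\+
   and f^\-, and +oo - +oo = -oo in \bar R; hence it is -oo as soon as the
   integral of min(f, 0) is -oo. *)
Definition budget_feasible (R : realType) (d : measure_display)
    (S : measurableType d) (mu : {sigma_finite_measure set S -> \bar R})
    (zeta a0 a : S -> R) : Prop :=
  L0_plus a /\ (\int[mu]_s (zeta s * (a s - a0 s))%:E = 0)%E.

(* "The" maximizer: uniqueness is up to mu-null sets. *)
Definition the_maximizer (R : realType) (d : measure_display)
    (S : measurableType d) (mu : {sigma_finite_measure set S -> \bar R})
    (U : R -> S -> \bar R) (zeta a0 a1 : S -> R) : Prop :=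
  [/\ budget_feasible mu zeta a0 a1,
      forall a, budget_feasible mu zeta a0 a ->
        (\int[mu]_s field_comp U a s <= \int[mu]_s field_comp U a1 s)%E &
      forall a, budget_feasible mu zeta a0 a ->
        (\int[mu]_s field_comp U a s = \int[mu]_s field_comp U a1 s)%E ->
        {ae mu, forall s, a s = a1 s}].

Definition arrow_debreu_equilibrium (R : realType) (d : measure_display)
    (S : measurableType d) (mu : {sigma_finite_measure set S -> \bar R})
    (M : nat) (U : 'I_M -> R -> S -> \bar R) (Lambda : S -> R)
    (alpha0 : 'I_M -> S -> R) (zeta : S -> R) (alpha1 : 'I_M -> S -> R) : Prop :=
  [/\ measurable_fun setT zeta /\ {ae mu, forall s, 0 < zeta s},
      allocation mu Lambda alpha1,
      (\int[mu]_s (zeta s * Lambda s)%:E < +oo)%E &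
      forall m,
        (\int[mu]_s `|field_comp (U m) (alpha1 m) s| < +oo)%E /\
        the_maximizer mu (U m) zeta (alpha0 m) (alpha1 m)].

(* Main.v *)
(* Negishi's method.  For weights w in the simplex, the Pareto optimal allocation
   equalizes the weighted marginal utilities w_m U_m'(pi_m) = zeta, i.e.
   pi_m = I_m (w_m X) with X = 1 / zeta, where I_m x inverts c |-> 1 / U_m' c
   and extends continuously by I_m 0 = 0, and X solves
   sum_m I_m (w_m X) = Lambda.  In these variables everything is continuous
   in w up to the boundary of the simplex.  Some agent gets at least Lambda / M, so
   zeta <= sum_m U_m'(Lambda / M), and by concavity
   U_m'(Lambda / M) Lambda / (2M) <= U_m(Lambda / M) - U_m(Lambda / (2M)): this
   dominates zeta Lambda, so the mean excesses E[zeta (pi_m - alpha0_m)] are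
   continuous in w.  They sum to 0 and the m-th one is negative where w_m = 0,
   hence a KKM argument gives positive weights at which they all vanish.
   Optimality of pi_m under the budget constraint is then the tangent
   inequality U_m(a) <= U_m(pi_m) + (zeta / w_m) (a - pi_m), strict for a <> pi_m.

   The KKM lemma is deduced from Scarf's combinatorial lemma on finite sets with
   several linear orders, which needs no triangulation. *)

Require Import Defs.
From HB Require Import structures.
From mathcomp Require Import all_boot zify.

Set Implicit Arguments.
Unset Strict Implicit.
Unset Printing Implicit Defensive.

(** * Scarf's lemma and the KKM lemma *)

Section Scarf.
Context (I T : finType) (r : I -> T -> nat).
Hypothesis r_inj : forall i, injective (r i).

(** No [y] lies strictly above the lowest elements of [A] in all orders at once. Dominant sets of
    size [#|I|], the rooms, act as the cells of a subdivision, and those of size [#|I| - 1] as their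
    facets. *)
Definition dominant (A : {set T}) :=
  [forall y, [exists i, [forall x in A, r i y <= r i x]]].

Lemma dominantP (A : {set T}) :
  reflect (forall y, exists i, forall x, x \in A -> r i y <= r i x) (dominant A).
Proof.
apply: (iffP forallP) => domA y.
  by have /existsP[i /forall_inP iy] := domA y; exists i.
by have [i iy] := domA y; apply/existsP; exists i; apply/forall_inP.
Qed.

Lemma dominant_sub (A B : {set T}) : B \subset A -> dominant A -> dominant B.
Proof.
move=> /subsetP BA /dominantP domA; apply/dominantP => y.
by have [i iy] := domA y; exists i => x /BA; exact: iy.
Qed.

(** * Rooms adjacent to a facet *)

Section Facet.
Context (B : {set T}) (x0 : T).
Hypotheses (domB : dominant B) (cardB : #|B|.+1 = #|I|) (x0B : x0 \in B).

Definition lowest i := [arg min_(x < x0 in B) r i x].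

Lemma lowest_in i : lowest i \in B.
Proof. by rewrite /lowest; case: arg_minnP. Qed.

Lemma lowest_le i x : x \in B -> r i (lowest i) <= r i x.
Proof. by move=> xB; rewrite /lowest; case: arg_minnP => // y yB; apply. Qed.

Lemma lowestE i x : x \in B -> (forall y, y \in B -> r i x <= r i y) -> lowest i = x.
Proof.
move=> xB xmin; apply: (@r_inj i); apply/eqP.
by rewrite eqn_leq lowest_le//= xmin// lowest_in.
Qed.

(** Dominance of [B], tested at [x] itself, gives an order in which [x] lies below all of [B]. *)
Lemma lowest_onto x : x \in B -> exists i, lowest i = x.
Proof. by move=> xB; have /dominantP/(_ x)[i ix] := domB; exists i; exact: lowestE. Qed.

(** Without [k] there are as many orders as elements of [B], so a surjection is injective. *)
Lemma lowest_inj k : (forall x, x \in B -> exists2 i, i != k & lowest i = x) ->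
  {in predC1 k &, injective lowest}.
Proof.
move=> onto; pose D := [set~ k].
have imD : lowest @: D = B.
  apply/setP => x; apply/imsetP/idP => [[i _ ->]|]; first exact: lowest_in.
  by move=> /onto[i ik <-]; exists i => //; rewrite !inE.
have /imset_injP injD : #|lowest @: D| == #|D|.
  by rewrite imD cardsC1 -cardB.
by move=> i j; rewrite !inE => ik jk; apply: injD; rewrite !inE.
Qed.

Lemma lowest_collision : exists i j, i != j /\ lowest i = lowest j.
Proof.
have /injectivePn[i [j ij fij]] : ~~ injectiveb lowest.
  apply/negP => /injectiveP finj.
  have := max_card (mem (lowest @: [set: I])).
  have : #|lowest @: [set: I]| <= #|B|.
    by apply/subset_leq_card/subsetP => x /imsetP[i _ ->]; exact: lowest_in.
  by rewrite card_imset// cardsT -cardB ltnn.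
by exists j, i; rewrite eq_sym.
Qed.

Definition beats k y := [forall l, (l != k) ==> (r l (lowest l) < r l y)].

Lemma beatsP k y :
  reflect (forall l, l != k -> r l (lowest l) < r l y) (beats k y).
Proof.
by apply: (iffP forallP) => H l; [move: (H l) => /implyP|apply/implyP; exact: H].
Qed.

Section Pair.
Context (i j : I).
Hypotheses (ij : i != j) (fij : lowest i = lowest j).

Lemma pair_onto k : k \in pred2 i j ->
  forall x, x \in B -> exists2 l, l != k & lowest l = x.
Proof.
move=> kij x /lowest_onto[l lx]; have [lk|] := eqVneq l k; last by exists l.
move: kij lx; rewrite inE lk => /orP[] /eqP -> <-; first by exists j; rewrite // eq_sym.
by exists i.
Qed.

Lemma pair_inj k : k \in pred2 i j -> {in predC1 k &, injective lowest}.
Proof. by move=> /pair_onto; exact: lowest_inj. Qed.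

(** [lowest] is injective away from [i] and away from [j], so every collision involves both. *)
Lemma pair_uniq a b : a != b -> lowest a = lowest b -> (i = a /\ j = b) \/ (i = b /\ j = a).
Proof.
move=> ab fab.
have H k : k \in pred2 i j -> (k == a) || (k == b).
  move=> kij; apply/negPn/negP; rewrite negb_or => /andP[ka kb].
  have := pair_inj kij; move=> /(_ a b); rewrite !inE ![_ == k]eq_sym ka kb.
  by move=> /(_ isT isT fab)/eqP; apply/negP.
have := H i; have := H j; rewrite !inE !eqxx orbT /= => /(_ isT) + /(_ isT).
move=> /orP[] /eqP ja /orP[] /eqP ia; [|by right|by left|];
  by move: ij; rewrite ia ja eqxx.
Qed.

Lemma beats_notin k y : k \in pred2 i j -> beats k y -> y \notin B.
Proof.
move=> kij /beatsP yk; apply/negP => /(pair_onto kij)[l lk ly].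
by have := yk _ lk; rewrite ly ltnn.
Qed.

(** Such a [y] would lie above the lowest element of [B] in every order, against dominance. *)
Lemma beats_excl y : beats i y -> beats j y -> False.
Proof.
move=> /beatsP yi /beatsP yj; have /dominantP/(_ y)[l ly] := domB.
have : r l (lowest l) < r l y.
  by have [li|] := eqVneq l i; [apply: yj; rewrite li|exact: yi].
by rewrite ltnNge ly// lowest_in.
Qed.

(** A [z] that beats [B] is tested in the order [k], where dominance of [B] puts [y] below [B]. Any
    other [z] is at most some lowest element of [B], which [y] exceeds. *)
Lemma room_of_beats k y : k \in pred2 i j -> beats k y ->
  (forall z, beats k z -> r k z <= r k y) -> dominant (y |: B).
Proof.
move=> kij yk ymax; apply/dominantP => z.
have [zk|] := boolP (beats k z).
  exists k => x; rewrite !inE => /orP[/eqP ->|xB]; first exact: ymax.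
  have /dominantP/(_ y)[l ly] := domB.
  have [lk|lk] := eqVneq l k; last first.
    by have /beatsP/(_ _ lk) := yk; rewrite ltnNge ly// lowest_in.
  by rewrite (leq_trans (ymax _ zk))// -lk ly.
move=> /forallPn[l]; rewrite negb_imply -leqNgt => /andP[lk zl].
exists l => x; rewrite !inE => /orP[/eqP ->|xB].
  by rewrite (leq_trans zl)// ltnW//; have /beatsP := yk; apply.
by rewrite (leq_trans zl)// lowest_le.
Qed.

(** Dominance gives an order [k] in which [y] is lowest in [y |: B]. Each [x] in [B] is then lowest
    in another order, so [lowest] is injective away from [k], and the collision forces [k] to be [i]
    or [j]. *)
Lemma beats_of_room y : y \notin B -> dominant (y |: B) ->
  exists2 k, k \in pred2 i j & beats k y /\ (forall z, beats k z -> r k z <= r k y).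
Proof.
move=> yB /dominantP dom; have [k ky] := dom y.
have onto x : x \in B -> exists2 l, l != k & lowest l = x /\ r l x < r l y.
  move=> xB; have [l lx] := dom x; exists l.
    apply/eqP => lk; move: yB; suff -> : y = x by rewrite xB.
    apply: (@r_inj k); apply/eqP; rewrite eqn_leq ky ?setU1r//= -lk lx//.
    by rewrite setU11.
  split; first by apply: lowestE => // z zB; apply: lx; rewrite setU1r.
  rewrite ltn_neqAle lx ?setU11// andbT; apply/eqP => /r_inj xy.
  by rewrite -xy xB in yB.
have inj : {in predC1 k &, injective lowest}.
  by apply: lowest_inj => x /onto[l lk [lx _]]; exists l.
have kij : k \in pred2 i j.
  apply/negPn/negP; rewrite !inE negb_or => /andP[ki kj].
  have := inj i j; rewrite !inE ![_ == k]eq_sym => /(_ ki kj fij)/eqP.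
  exact/negP.
have yk : beats k y.
  apply/beatsP => l lk; have [l' l'k [ll' l'y]] := onto _ (lowest_in l).
  have l'E : l' = l by apply: inj.
  by move: l'y; rewrite l'E.
exists k => //; split => // z /beatsP zk; have [l lz] := dom z.
have [lk|lk] := eqVneq l k; first by rewrite -lk lz// setU11.
by have := zk _ lk; rewrite ltnNge lz// setU1r// lowest_in.
Qed.

(* A facet B of size #|I| - 1 has exactly two indices i, j sharing their lowest
   element; an element y extends B to a dominant set iff, for k = i or k = j, it is
   the r k-largest element that beats B in all orders but k. *)
Definition rooms_of := [set y in ~: B | dominant (y |: B)].

Definition rooms_at k := [set y in rooms_of | beats k y].

Lemma card_rooms_at k : k \in pred2 i j -> #|rooms_at k| = [exists y, beats k y].
Proof.
move=> kij; case: existsP => [[y1 y1k]|nobeat]; last first.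
  by apply: eq_card0 => y; rewrite !inE; apply/negP => /andP[_ yk]; apply: nobeat; exists y.
pose y := [arg max_(y > y1 | beats k y) r k y].
have [yk ymax] : beats k y /\ forall z, beats k z -> r k z <= r k y.
  by rewrite /y; case: arg_maxnP.
apply/eqP; rewrite -[nat_of_bool true]/1; apply/cards1P; exists y.
apply/setP => z; rewrite !inE; apply/idP/eqP => [/andP[/andP[zB domz] zk]|->].
  have [k' k'ij [zk' zmax]] := beats_of_room zB domz.
  have [kk'|kk'] := eqVneq k' k.
    apply: (@r_inj k); apply/eqP; rewrite eqn_leq ymax//=.
    by rewrite -kk'; apply: zmax; rewrite kk'.
  exfalso; move: kij k'ij kk'; rewrite !inE => /orP[] /eqP kE /orP[] /eqP k'E; move: zk zk';
    rewrite kE k'E ?eqxx// => zk zk' _; first exact: (beats_excl zk zk').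
  exact: (beats_excl zk' zk).
by rewrite yk (beats_notin kij)//= (room_of_beats kij).
Qed.

Lemma card_rooms_of :
  #|rooms_of| = [exists y, beats i y] + [exists y, beats j y].
Proof.
rewrite -!card_rooms_at ?inE ?eqxx ?orbT// -cardsUI.
have -> : rooms_at i :&: rooms_at j = set0.
  apply/setP => y; rewrite !inE; apply/negP.
  by move=> /andP[/andP[_ yi] /andP[_ yj]]; exact: (beats_excl yi yj).
rewrite cards0 addn0; congr #|pred_of_set _|; apply/setP => y.
rewrite in_setU !in_set -andb_orr; case: (boolP (_ && _)) => //=.
move=> /andP[yB ydom]; have [k + [yk _]] := beats_of_room yB ydom.
by rewrite inE => /orP[] /eqP <-; rewrite yk ?orbT.
Qed.

End Pair.
End Facet.

(** * Slack elements, parity and the double count *)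

Section Slack.
Context (s : I -> T) (x1 : T).
Hypotheses (s_low : forall i x, r i (s i) <= r i x)
  (s_high : forall i j x, i != j -> x \notin codom s -> r i x < r i (s j))
  (x1s : x1 \notin codom s) (I_gt1 : 1 < #|I|).

Lemma slack_inj : injective s.
Proof.
move=> i j sij; apply/eqP/negPn/negP => ij.
have := s_high ij x1s; rewrite -sij => /leq_trans/(_ (s_low i x1)).
by rewrite ltnn.
Qed.

(* The slack element s i is lowest for r i and above all genuine elements for
   the other orders: it plays the role of the face on which the i-th coordinate
   vanishes, so that all facets but the s @: [set~ p] are interior. *)
Lemma odd_card_rooms_of (B : {set T}) : dominant B -> #|B|.+1 = #|I| ->
  odd #|rooms_of B| = [exists p, B == s @: [set~ p]].
Proof.
move=> domB cardB.
have [x0 x0B] : exists x0, x0 \in B.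
  by apply/set0Pn; rewrite -card_gt0 -ltnS cardB.
have [i [j [ij fij]]] := lowest_collision cardB x0B.
rewrite (card_rooms_of domB cardB x0B ij fij).
have [/subsetP Bs|] := boolP (B \subset codom s); last first.
  (* A genuine element [x] of [B] is exceeded by [s k] in all orders but [k], so both sides carry a
     room: an even number. *)
  move=> /subsetPn[x xB xs].
  have all_beat k : [exists y, beats B x0 k y].
    apply/existsP; exists (s k); apply/beatsP => l lk.
    by rewrite (leq_ltn_trans (lowest_le x0B _ xB))// s_high.
  rewrite !all_beat; apply/esym/negbTE/existsPn => p; apply/eqP => Bp.
  by move: xs; move: xB; rewrite Bp => /imsetP[l _ ->]; rewrite codom_f.
have sB : s @: (s @^-1: B) = B.
  apply/setP => x; apply/imsetP/idP => [[k]|xB]; first by rewrite inE => + ->.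
  by have /codomP[k xk] := Bs _ xB; exists k; rewrite ?inE -?xk.
have [p sBp] : exists p, s @^-1: B = [set~ p].
  have : #|~: (s @^-1: B)| == 1.
    have := cardsC (s @^-1: B); rewrite -(card_imset _ slack_inj) sB -cardB.
    by rewrite -addn1 => /addnI ->.
  by move=> /cards1P[p Hp]; exists p; rewrite -Hp setCK.
have Bp : B = s @: [set~ p] by rewrite -sB sBp.
have sB_in q : q != p -> s q \in B by move=> qp; rewrite Bp imset_f// !inE.
have low q : q != p -> lowest B x0 q = s q.
  by move=> qp; apply: lowestE => //; exact: sB_in.
have [p0 p0p lowp] : exists2 p0, p0 != p & lowest B x0 p = s p0.
  have : lowest B x0 p \in s @: [set~ p] by rewrite -Bp lowest_in.
  move=> /imsetP[p0 p0p ->].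
  by exists p0 => //; rewrite !inE in p0p.
have -> : [exists p1, B == s @: [set~ p1]] by apply/existsP; exists p; apply/eqP.
have beat_p : [exists y, beats B x0 p y].
  apply/existsP; exists x1; apply/beatsP => q qp; rewrite low// ltn_neqAle s_low.
  rewrite andbT; apply/eqP => /r_inj E; move: x1s; rewrite -E.
  by rewrite codom_f.
(* Beating on the side [p0] requires exceeding [s p0] in the order [p], which only a slack element
   can do, and each of these fails in some order. So the only room lies on the side [p]. *)
have nobeat_p0 : [exists y, beats B x0 p0 y] = false.
  apply/negbTE/existsPn => y; apply/negP => /beatsP yp0.
  have := yp0 p; rewrite eq_sym p0p lowp => /(_ isT) yp.
  have ys : y \in codom s.
    apply/negPn/negP => /(@s_high p p0); rewrite eq_sym p0p => /(_ isT).
    by rewrite ltnNge ltnW.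
  case/codomP: ys yp yp0 => q -> yp yp0.
  have [qp|qp] := eqVneq q p; first by rewrite qp ltnNge s_low in yp.
  have [qp0|qp0] := eqVneq q p0; first by rewrite qp0 ltnn in yp.
  by have := yp0 _ qp0; rewrite low// ltnn.
have lpp0 : lowest B x0 p = lowest B x0 p0 by rewrite lowp low.
have pp0 : p != p0 by rewrite eq_sym.
by have [[-> ->]|[-> ->]] := pair_uniq domB cardB x0B ij fij pp0 lpp0;
  rewrite beat_p nobeat_p0.
Qed.

Context (c : T -> I).
Hypothesis c_slack : forall i, c (s i) = i.

Definition cofacets i0 (A : {set T}) := [set y in A | c @: (A :\ y) == [set~ i0]].

(** If the colour [i0] is missing although a cofacet exists, exactly two elements [y] and [y'] of
    [A] share a colour; the cofacets are these two, an even number. *)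
Lemma rainbow_of_odd i0 (A : {set T}) :
  #|A| = #|I| -> odd #|cofacets i0 A| -> c @: A = [set: I].
Proof.
move=> cardA oddA; have /set0Pn[y] : cofacets i0 A != set0.
  by apply: contraTneq oddA => ->; rewrite cards0.
rewrite inE => /andP[yA /eqP cAy].
have cA : c @: A = c y |: [set~ i0] by rewrite -cAy -imsetU1 setD1K.
have [ci0|ci0] := eqVneq (c y) i0; first by rewrite cA ci0 setUCr.
exfalso.
have inj : {in A :\ y &, injective c}.
  apply/imset_injP; rewrite cAy cardsC1 -cardA.
  by rewrite (cardsD1 y A) yA.
have : c y \in c @: (A :\ y) by rewrite cAy !inE.
move=> /imsetP[y' y'A cyy'].
have y'y : y' != y by move: y'A; rewrite !inE => /andP[].
suff E : cofacets i0 A = [set y; y'].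
  by move: oddA; rewrite E cards2 eq_sym y'y.
apply/setP => z; rewrite !inE; apply/idP/orP => [/andP[zA /eqP cAz]|[/eqP ->|/eqP ->]].
- have [->|zy] := eqVneq z y; first by left.
  right; have : c z \in c @: (A :\ z).
    by rewrite cAz -cAy imset_f// !inE zy.
  move=> /imsetP[w wA czw].
  have [wy|wy] := eqVneq w y.
    by apply/eqP/inj => //; rewrite ?inE ?zy// czw wy.
  move: wA; rewrite !inE => /andP[wz wA].
  by move/eqP: wz; case; apply: inj => //; rewrite !inE ?zy ?wy.
- by rewrite yA cAy eqxx.
- move: y'A; rewrite !inE => /andP[_ y'A]; rewrite y'A /= -cAy.
  apply/eqP/setP => a; apply/imsetP/imsetP => [[w]|[w]]; rewrite !inE => /andP[wy wA] ->.
    have [->|w'] := eqVneq w y; first by exists y'; rewrite // !inE y'y.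
    by exists w; rewrite // !inE w'.
  have [->|w'] := eqVneq w y'; last by exists w; rewrite // !inE w'.
  by exists y; rewrite // !inE eq_sym y'y.
Qed.

(* Double counting, modulo 2, of the pairs (B, y) where y |: B is a room and B is
   a facet with colours [set~ i0]: only the facet s @: [set~ i0] contributes an
   odd number, so some room has an odd number of such facets. *)
Lemma scarf : exists A : {set T}, [/\ dominant A, #|A| = #|I| & c @: A = [set: I]].
Proof.
have [i0 _] : exists i0 : I, i0 \in I by apply/card_gt0P; exact: ltnW.
pose room (A : {set T}) := dominant A && (#|A| == #|I|).
pose door (B : {set T}) := [&& dominant B, #|B|.+1 == #|I| & c @: B == [set~ i0]].
have count : \sum_(B | door B) #|rooms_of B| = \sum_(A | room A) #|cofacets i0 A|.
  under eq_bigr do rewrite -sum1_card; under [RHS]eq_bigr do rewrite -sum1_card.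
  rewrite (pair_big_dep door (fun B y => y \in rooms_of B) (fun _ _ => 1)).
  rewrite (pair_big_dep room (fun A y => y \in cofacets i0 A) (fun _ _ => 1)) /=.
  (* [h] and [h'] pass between a room with a chosen element and a facet with an added element, so
     both sums count the same pairs. *)
  pose h (p : {set T} * T) := (p.1 :\ p.2, p.2).
  pose h' (p : {set T} * T) := (p.2 |: p.1, p.2).
  rewrite (reindex_onto h h') => [|[B y]] /=; last first.
    rewrite !inE => /andP[_ /andP[yB _]]; rewrite /h /h' /=; congr pair.
    by rewrite setU1K.
  apply: eq_bigl => -[A y] /=; rewrite /h /h' /=.
  rewrite !inE eqxx /= xpair_eqE eqxx andbT.
  have [yA|yA] := boolP (y \in A); last first.
    rewrite andbF; apply/negbTE/negP => /andP[_ /eqP E].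
    by move: yA; rewrite -E setU11.
  rewrite setD1K// eqxx andbT /door /room /=.
  have -> : #|A :\ y|.+1 = #|A| by rewrite (cardsD1 y A) yA.
  have [domA|] := boolP (dominant A); last by rewrite andbF.
  by rewrite (dominant_sub (subsetDl _ _) domA) /= andbT.
have odd_doors : odd (\sum_(B | door B) #|rooms_of B|).
  have oddE B : door B -> odd #|rooms_of B| = (B == s @: [set~ i0]).
    move=> /and3P[domB /eqP cardB /eqP cB]; rewrite odd_card_rooms_of//.
    apply/existsP/eqP => [[p /eqP Bp]|->]; last by exists i0.
    rewrite Bp; congr (_ @: _); rewrite -cB Bp -imset_comp.
    by rewrite (eq_imset (g := id)) ?imset_id//.
  have door0 : door (s @: [set~ i0]).
    rewrite /door card_imset; last exact: slack_inj.
    rewrite cardsC1 prednK ?eqxx ?(ltnW I_gt1)//=; apply/andP; split; last first.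
      by rewrite -imset_comp (eq_imset (g := id)) ?imset_id// => x /=.
    apply/dominantP => y; have [/codomP[k ->]|ys] := boolP (y \in codom s).
      by exists k.
    exists i0 => x /imsetP[q]; rewrite !inE => qi0 ->.
    by rewrite ltnW// s_high// eq_sym.
  rewrite (bigD1 (s @: [set~ i0])) //= oddD oddE// eqxx /= .
  rewrite (big_morph odd oddD erefl) big1// => B /andP[dB /negbTE nB].
  by rewrite oddE.
have [A /andP[rA oA]] : exists A, room A && odd #|cofacets i0 A|.
  apply/existsP; apply: contraT => /existsPn none.
  move: odd_doors; rewrite count (big_morph odd oddD erefl) big1// => A rA.
  by have := none A; rewrite rA => /negbTE.
have /andP[domA /eqP cardA] := rA.
by exists A; split => //; exact: rainbow_of_odd oA.
Qed.
End Slack.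
End Scarf.

(** * A Sperner lemma on the integer points of a simplex *)

Section Grid.
Context (M n : nat).

Definition grid := {x : {ffun 'I_M -> 'I_n.+1} | \sum_i (x i : nat) == n}.

(* The i-th coordinate, with ties broken by the enumeration of the grid; inr j is
   the j-th slack element. *)
Definition grid_rank (i : 'I_M) (t : grid + 'I_M) : nat :=
  match t with
  | inl x => (sval x i * #|{: grid}| + enum_rank x).+1
  | inr j => if j == i then 0 else (n.+1 * #|{: grid}| + j).+1
  end.

Lemma grid_rank_lt (i : 'I_M) (x : grid) :
  sval x i * #|{: grid}| + enum_rank x < n.+1 * #|{: grid}|.
Proof.
have := ltn_ord (enum_rank x); set K := #|_|; set k := nat_of_ord _ => kK.
have := ltn_ord (sval x i); set p := nat_of_ord _ => pn.
by rewrite (@leq_trans (p.+1 * K))// ?leq_mul2r ?pn ?orbT// mulSn addnC ltn_add2r.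
Qed.

Lemma grid_rank_inj i : injective (grid_rank i).
Proof.
move=> [x|j] [y|k] /=.
- move=> [E]; congr inl; apply: enum_rank_inj; apply: val_inj => /=.
  have := congr1 (modn^~ #|{: grid}|) E.
  by rewrite !modnMDl !modn_small.
- case: eqP => // _ [E]; have := grid_rank_lt i x; rewrite E ltnNge.
  by rewrite leq_addr.
- case: eqP => // _ [E]; have := grid_rank_lt i y; rewrite -E ltnNge.
  by rewrite leq_addr.
- have [->|] := eqVneq j i; have [->|] := eqVneq k i => //.
  by move=> _ _ [/addnI] /val_inj ->.
Qed.

(** The coordinate is the leading digit of the rank in base [#|{: grid}|], so the tie-breaker never
    reverses two coordinates. *)
Lemma grid_rank_le (i : 'I_M) (x y : grid) : grid_rank i (inl x) <= grid_rank i (inl y) ->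
  sval x i <= sval y i.
Proof.
move=> /=; rewrite ltnS; have := ltn_ord (enum_rank y); set K := #|_|.
set p := nat_of_ord (enum_rank x); set q := nat_of_ord (enum_rank y) => qK le.
rewrite leqNgt; apply/negP => lt.
have : (sval y i).+1 * K <= sval x i * K by rewrite leq_mul2r lt orbT.
rewrite leqNgt => /negP; apply; rewrite mulSn addnC.
by rewrite (leq_ltn_trans _ (leq_ltn_trans le _)) ?leq_addr ?ltn_add2l.
Qed.

Lemma grid_of (y : 'I_M -> nat) : \sum_i y i = n ->
  exists x : grid, forall i, sval x i = y i :> nat.
Proof.
move=> yn; have y_le i : y i < n.+1.
  by rewrite ltnS -yn (bigD1 i)//= leq_addr.
have xP : \sum_i (([ffun i => Ordinal (y_le i)] : {ffun _ -> _}) i : nat) == n.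
  by rewrite -[X in _ == X]yn; apply/eqP/eq_bigr => i _; rewrite ffunE.
by exists (Sub [ffun i => Ordinal (y_le i)] xP) => i /=; rewrite ffunE.
Qed.

(** The genuine elements of a rainbow room lie within [M] of one another: their coordinates sum to
    [n], while the common lower bounds [a] sum to more than [n - M]. A slack element in the room
    marks a coordinate close to 0. *)
Lemma grid_sperner (c : grid -> 'I_M) : 1 < M ->
  exists x : grid, forall i, sval x i <= M \/
    exists2 z : grid, c z = i &
      forall j, sval z j <= sval x j + M /\ sval x j <= sval z j + M.
Proof.
move=> M_gt1; pose i1 : 'I_M := Ordinal (ltnW M_gt1).
have [x1 _] : exists x : grid, forall i, sval x i = (if i == i1 then n else 0) :> nat.
  by apply: grid_of; rewrite -big_mkcond big_pred1_eq.
pose c' (t : grid + 'I_M) := match t with inl x => c x | inr j => j end.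
have inl_slack x : (inl x : grid + 'I_M) \notin codom (@inr grid 'I_M).
  by apply/negP => /codomP[].
have [||||//|A [/dominantP domA cardA cA]] :=
  @scarf _ _ _ grid_rank_inj (@inr grid 'I_M) (inl x1) _ _ _ _ c'.
- by move=> i [x|j] /=; rewrite eqxx.
- move=> i j [x|k] ij; last by rewrite codom_f.
  by move=> _ /=; rewrite eq_sym (negbTE ij) ltnS ltn_addr// grid_rank_lt.
- exact: inl_slack.
- by rewrite card_ord.
pose C := [set i | inr i \notin A].
have colored i : i \in C -> exists2 z : grid, inl z \in A & c z = i.
  rewrite inE => iA; have : i \in c' @: A by rewrite cA.
  by move=> /imsetP[[z zA ->|j jA ij]]; [exists z|move: iA; rewrite ij jA].
(* The order found by dominance cannot be that of a slack element of the room, whose rank 0 is below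
   all genuine ranks. *)
have domC (y : grid) : exists2 i, i \in C & forall x : grid, inl x \in A -> sval y i <= sval x i.
  have [i iy] := domA (inl y); exists i => [|x xA]; last exact/grid_rank_le/iy.
  by rewrite inE; apply/negP => /iy; rewrite /grid_rank eqxx.
have [x0 x0A] : exists x0 : grid, inl x0 \in A.
  by have [i /colored[z zA _] _] := domC x1; exists z.
pose a j := if j \in C then sval [arg min_(x < x0 | inl x \in A) sval x j] j : nat else 0.
have a_le (x : grid) j : inl x \in A -> a j <= sval x j.
  by move=> xA; rewrite /a; case: ifP => // _; case: arg_minnP => // z _; apply.
have a_att j : j \in C -> exists2 x : grid, inl x \in A & sval x j = a j :> nat.
  by move=> jC; rewrite /a jC; case: arg_minnP => // z zA _; exists z.
have sum_a : n < \sum_j a j + M.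
  rewrite ltnNge; apply/negP => le_n.
  (* Otherwise some grid point [y] exceeds every [a j] by at least 1, the surplus going to [i1].
     Dominance at [y] then contradicts a minimum attained in the room. *)
  have [|y yE] := @grid_of (fun j => a j + 1 + (if j == i1 then n - (\sum_j a j + M) else 0)).
    rewrite big_split big_split /= sum1_card card_ord -[RHS](subnKC le_n).
    by congr (_ + _); rewrite -big_mkcond big_pred1_eq.
  have [i iC iy] := domC y; have [x xA xi] := a_att _ iC.
  by have := iy _ xA; rewrite yE xi; lia.
exists x0 => i; have x_lt (x : grid) : inl x \in A -> forall j, sval x j < a j + M.
  move=> xA j; have : \sum_i (sval x i : nat) = n by apply/eqP; exact: (svalP x).
  rewrite (bigD1 j)//= => E; move: sum_a E; rewrite (bigD1 j)//=.
  have : \sum_(i < M | i != j) a i <= \sum_(i < M | i != j) sval x i.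
    by apply: leq_sum => k _; exact: a_le.
  move: (\sum_(i < M | i != j) _) (\sum_(i < M | i != j) a i) => q p pq lt E.
  by rewrite -(ltn_add2r q) E (leq_trans lt)// addnAC leq_add2l.
have [iC|iC] := boolP (i \in C); last first.
  by left; have := x_lt _ x0A i; rewrite /a (negbTE iC) add0n => /ltnW.
right; have [z zA cz] := colored _ iC; exists z => // j.
by split; apply/ltnW; [apply: leq_trans (x_lt _ zA j) _|apply: leq_trans (x_lt _ x0A j) _];
  rewrite leq_add2r a_le.
Qed.
End Grid.

From mathcomp Require Import all_order all_algebra.
From mathcomp Require Import all_classical all_reals all_analysis measurable_realfun.
From mathcomp Require Import ring lra.

Import Order.TTheory GRing.Theory Num.Theory.
Import numFieldNormedType.Exports.

Local Open Scope classical_set_scope.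
Local Open Scope ring_scope.

(** * Compactness of the simplex and the KKM lemma *)

Section Simplex.
Context (R : realType) (M : nat).
Implicit Types (w : 'I_M -> R) (u : nat -> 'I_M -> R).

Definition simplex : set ('I_M -> R) :=
  [set w | (forall i, 0 <= w i) /\ \sum_i w i = 1].

Lemma simplex_le1 w i : simplex w -> w i <= 1.
Proof.
by move=> [w0 <-]; rewrite (bigD1 i)//= lerDl sumr_ge0.
Qed.

Definition ptw_cvg u w := forall j, u n j @[n --> \oo] --> w j.

Lemma increasing_seq_ge (f : nat -> nat) n : increasing_seq f -> (n <= f n)%N.
Proof.
move=> /increasing_seqP fS; elim: n => // n IH.
by rewrite (leq_ltn_trans IH)//; exact: fS.
Qed.

Lemma cvg_increasing_seq (f : nat -> nat) : increasing_seq f -> f n @[n --> \oo] --> \oo.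
Proof.
move=> fi A [N _ NA]; exists N => // n /= Nn; apply: NA => /=.
exact: leq_trans (increasing_seq_ge _ fi).
Qed.

Lemma simplex_ptw_closed u w : (forall n, simplex (u n)) -> ptw_cvg u w -> simplex w.
Proof.
move=> uS uw; split=> [i|].
  by apply: cvgr_to_ge (uw i) _; apply: nearW => n; case: (uS n).
have sum_cvg : \sum_i u n i @[n --> \oo] --> \sum_i w i.
  by apply: cvg_big => [|i _]; [exact: add_continuous|exact: uw].
have : (fun n => \sum_i u n i) @ \oo --> (1 : R).
  by under eq_cvg do rewrite (uS _).2; exact: cvg_cst.
exact: norm_cvg_unique sum_cvg.
Qed.

(** Bolzano-Weierstrass, applied to one coordinate after the other. *)
Lemma simplex_subseq u : (forall n, simplex (u n)) ->
  exists2 f : nat -> nat, increasing_seq f & exists w, ptw_cvg (u \o f) w.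
Proof.
move=> uS.
suff [f fi fc] : exists2 f : nat -> nat, increasing_seq f &
    forall j, j \in enum 'I_M -> cvgn (fun n => u (f n) j).
  exists f => //; exists (fun j => limn (fun n => u (f n) j)) => j.
  by apply: fc; rewrite mem_enum.
elim: (enum 'I_M) => [|a s [f fi fc]]; first by exists id.
have [|g gi gc] := @bolzano_weierstrass R (fun n => u (f n) a).
  exists 1; split => // x x1 n _ /=; rewrite ger0_norm; last by case: (uS (f n)).
  by rewrite (le_trans _ (ltW x1))// simplex_le1.
exists (f \o g) => [m n|j]; first by rewrite /= fi; exact: gi.
rewrite inE => /orP[/eqP ->//|js].
have /cvg_ex[l fl] := fc _ js; apply/cvg_ex; exists l.
apply: cvg_comp fl.
exact: cvg_increasing_seq.
Qed.

(** Scaling the grid of total [n.+1] turns the distance [M] of [grid_sperner] into the mesh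
    [M / n.+1]. *)
Lemma sperner_approx (A : 'I_M -> set ('I_M -> R)) (n : nat) : (0 < M)%N ->
  (forall w, simplex w -> exists i, A i w) ->
  exists w, simplex w /\ forall i, w i <= M%:R * n.+1%:R^-1 \/
    exists z, [/\ simplex z, A i z & forall j, `|z j - w j| <= M%:R * n.+1%:R^-1].
Proof.
move=> M_gt0 coverA.
(* [grid_sperner] assumes two coordinates; for [M = 1] the simplex is a single point. *)
have [M_gt1|M_le1] := ltnP 1 M; last first.
  have I_uniq (i j : 'I_M) : i = j.
    by apply: val_inj => /=; have := ltn_ord i; have := ltn_ord j; lia.
  have wS : simplex (fun _ : 'I_M => 1 : R).
    by split=> //; rewrite sumr_const card_ord (_ : M = 1%N)//; lia.
  have [i Ai] := coverA _ wS; exists (fun=> 1); split=> // j; right.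
  exists (fun=> 1); split => // [|k]; first by rewrite (I_uniq j i).
  by rewrite subrr normr0 mulr_ge0// invr_ge0.
have n0 : 0 < n.+1%:R :> R by [].
pose scale (x : grid M n.+1) (i : 'I_M) : R := (sval x i)%:R * n.+1%:R^-1.
have scaleS x : simplex (scale x).
  split=> [i|]; first by rewrite mulr_ge0// invr_ge0.
  rewrite -mulr_suml -natr_sum; have /eqP -> := svalP x.
  by rewrite divff// gt_eqF.
have /choice[c Ac] : forall x, exists i, A i (scale x) by move=> x; exact: coverA.
have [x xP] := grid_sperner c M_gt1.
exists (scale x); split=> // i; have [xi|[z zi zx]] := xP i; [left|right].
  by rewrite ler_pM2r ?invr_gt0// ler_nat.
exists (scale z); split; [exact: scaleS|by rewrite -zi|].
move=> j; rewrite -mulrBl normrM (ger0_norm (_ : 0 <= n.+1%:R^-1)) ?invr_ge0//.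
rewrite ler_pM2r ?invr_gt0// ler_norml.
have [zx1 xz1] := zx j.
have : (sval z j)%:R <= (sval x j)%:R + M%:R :> R by rewrite -natrD ler_nat.
have : (sval x j)%:R <= (sval z j)%:R + M%:R :> R by rewrite -natrD ler_nat.
lra.
Qed.

(** Approximate solutions with mesh tending to 0 accumulate at some [w]. Where [w i = 0] the face
    condition applies; where [w i > 0] the coordinate eventually exceeds the mesh, so points of
    [A i] converge to [w]. Closedness is stated along sequences, the form in which dominated
    convergence provides it. *)
Lemma kkm (A : 'I_M -> set ('I_M -> R)) : (0 < M)%N ->
  (forall i u w, (forall n, simplex (u n)) -> ptw_cvg u w ->
    (forall n, A i (u n)) -> A i w) ->
  (forall w, simplex w -> exists i, A i w) ->
  (forall i w, simplex w -> w i = 0 -> A i w) ->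
  exists2 w, simplex w & forall i, A i w.
Proof.
move=> M_gt0 closedA coverA faceA.
have [v vP] := choice (fun n => sperner_approx n M_gt0 coverA).
have vS n : simplex (v n) by case: (vP n).
have [f fi [w vw]] := simplex_subseq vS.
have wS : simplex w by apply: simplex_ptw_closed vw => n; exact: vS.
exists w => // i.
have [w0|w0] := eqVneq (w i) 0; first exact: faceA.
have wi_gt0 : 0 < w i by rewrite lt_neqAle eq_sym w0 wS.1.
have eps0 : M%:R * (f n).+1%:R^-1 @[n --> \oo] --> (0 : R).
  rewrite -[X in _ --> X](mulr0 M%:R); apply: cvgMl_tmp.
  exact: cvg_comp (cvg_increasing_seq fi) cvg_harmonic.
have [N _ NP] : \forall n \near \oo, M%:R * (f n).+1%:R^-1 < v (f n) i.
  have w2_gt0 : 0 < w i / 2 by rewrite divr_gt0.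
  have w2_lt : w i / 2 < w i by rewrite ltr_pdivrMr// ltr_pMr// ltr1n.
  near=> n; apply: (@lt_trans _ _ (w i / 2)); near: n.
    exact: cvgr_lt eps0 _ w2_gt0.
  exact: cvgr_gt (vw i) _ w2_lt.
(* After the shift by [N], the alternative with a nearby point of [A i] holds for every index. *)
have /choice[z zP] : forall n, exists z, [/\ simplex z, A i z &
    forall j, `|z j - v (f (n + N)%N) j| <= M%:R * (f (n + N)%N).+1%:R^-1].
  move=> n; have [_ /(_ i)[|//]] := vP (f (n + N)%N).
  by rewrite leNgt NP//= leq_addl.
apply: (closedA _ z); [by move=> n; case: (zP n)| |by move=> n; case: (zP n)].
move=> j; have vj := vw j.
rewrite -(cvg_shiftn N) in vj; rewrite -(cvg_shiftn N) in eps0.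
have : z n j - v (f (n + N)%N) j @[n --> \oo] --> (0 : R).
  apply: norm_cvg0; apply: (squeeze_cvgr _ (cvg_cst 0) eps0).
  by apply: nearW => n; rewrite normr_ge0 /=; have [_ _ /(_ j)] := zP n.
move=> /cvgD/(_ vj); rewrite add0r; apply: cvg_trans.
by apply: near_eq_cvg; apply: nearW => n /=; rewrite /= subrK.
Unshelve. all: by end_near. Qed.
End Simplex.

(** * Utility functions and random utility fields *)

Section Marginal.
Context (R : realType) (u : R -> R).
Hypotheses (u_inc : strictly_increasing_pos u) (u_conc : strictly_concave_pos u)
  (u_diff : continuously_differentiable_pos u).

Lemma derive1_right c : 0 < c -> h^-1 * (u (h + c) - u c) @[h --> 0^'+] --> derive1 u c.
Proof.
move=> c0; have [du _] := u_diff c0; apply: cvg_dnbhs_at_right.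
rewrite derive1E /derive.
have -> : (fun h => h^-1 * (u (h + c) - u c)) =
  (fun h => h^-1 *: ((u \o shift c) (h *: (1 : R^o)) - u c)).
  by apply/funext => h /=; rewrite /= [h *: _](mulr1 h).
exact: du.
Qed.

(** Convergence along a sequence makes marginal utilities measurable in the state, as pointwise
    limits. *)
Lemma derive1_seq c : 0 < c ->
  n.+1%:R * (u (n.+1%:R^-1 + c) - u c) @[n --> \oo] --> derive1 u c.
Proof.
move=> c0; have := derive1_right c0.
move=> /cvg_at_rightP/(_ (fun n => n.+1%:R^-1)).
have H : (forall n, 0 < n.+1%:R^-1 :> R) /\ n.+1%:R^-1 @[n --> \oo] --> (0 : R).
  by split=> [n|]; [rewrite invr_gt0|exact: cvg_harmonic].
move=> /(_ H); apply: cvg_trans; apply: near_eq_cvg; apply: nearW => n /=.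
by rewrite invrK.
Qed.

Lemma tangent_le x y : 0 < x -> 0 < y -> u y <= u x + derive1 u x * (y - x).
Proof.
move=> x0 y0; have [->|xy] := eqVneq y x; first by rewrite subrr mulr0 addr0.
rewrite -lerBlDl.
have lim : h^-1 * (u (h + x) - u x) * (y - x) @[h --> 0^'+] --> derive1 u x * (y - x).
  exact: cvgMr_tmp (derive1_right x0).
have [yx|{xy}yx|yx] := ltgtP y x; last by rewrite yx eqxx in xy.
- apply: cvgr_to_ge lim _; near=> h.
  have h0 : 0 < h by near: h; exact: nbhs_right_gt.
  rewrite -mulrA ler_pdivlMl//.
  (* Here [x] is a convex combination of [y] and [x + h], with weight [t] on [y]. *)
  pose t := h / (x - y + h).
  have xyh : 0 < x - y + h by lra.
  have xyh0 : x - y + h != 0 by rewrite gt_eqF.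
  have t01 : 0 < t < 1 by rewrite divr_gt0//= ltr_pdivrMr// mul1r; lra.
  have hx : 0 < h + x by lra.
  have yhx : y != h + x by rewrite lt_eqF//; lra.
  have := u_conc y0 hx yhx t01.
  have -> : t * y + (1 - t) * (h + x) = x by rewrite /t; field.
  move=> /ltW; rewrite -(ler_pM2l xyh).
  have -> : (x - y + h) * (t * u y + (1 - t) * u (h + x)) =
    h * u y + (x - y) * u (h + x) by rewrite /t; field.
  lra.
- have xy0 : 0 < y - x by lra.
  apply: cvgr_to_ge lim _; near=> h.
  have h0 : 0 < h by near: h; exact: nbhs_right_gt.
  have hyx : h < y - x by near: h; exact: nbhs_right_lt.
  rewrite -mulrA ler_pdivlMl//.
  (* Here [x + h] is a convex combination of [y] and [x], with weight [t] on [y]. *)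
  pose t := h / (y - x).
  have xyn0 : y - x != 0 by rewrite gt_eqF.
  have t01 : 0 < t < 1 by rewrite divr_gt0//= ltr_pdivrMr// mul1r.
  have yxn : y != x by rewrite gt_eqF.
  have := u_conc y0 x0 yxn t01.
  have -> : t * y + (1 - t) * x = h + x by rewrite /t; field.
  move=> /ltW; rewrite -(ler_pM2l xy0).
  have -> : (y - x) * (t * u y + (1 - t) * u x) =
    h * u y + (y - x - h) * u x by rewrite /t; field.
  lra.
Unshelve. all: by end_near. Qed.

(** Strict concavity at the midpoint, combined with the tangent bound there. *)
Lemma tangent_lt x y : 0 < x -> 0 < y -> y != x -> u y < u x + derive1 u x * (y - x).
Proof.
move=> x0 y0 yx; have half : 0 < (2^-1 : R) < 1 by lra.
have m0 : 0 < 2^-1 * y + (1 - 2^-1) * x by lra.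
have := u_conc y0 x0 yx half; have := tangent_le x0 m0.
have -> : 2^-1 * y + (1 - 2^-1) * x - x = 2^-1 * (y - x) by field.
lra.
Qed.

Lemma derive1_gt0 x : 0 < x -> 0 < derive1 u x.
Proof.
move=> x0; have x1 : 0 < x + 1 by lra.
have xx1 : x < x + 1 by lra.
have := tangent_le x0 x1; have := u_inc x0 xx1.
by rewrite [x + 1]addrC addrK mulr1; lra.
Qed.

(** Sum of the strict tangent inequalities at [x] and at [y]. *)
Lemma derive1_decr x y : 0 < x -> x < y -> derive1 u y < derive1 u x.
Proof.
move=> x0 xy; have y0 := lt_trans x0 xy.
have yx : y != x by rewrite gt_eqF.
have xy' : x != y by rewrite lt_eqF.
have xy0 : 0 < y - x by lra.
rewrite -(ltr_pM2r xy0); have := tangent_lt x0 y0 yx; have := tangent_lt y0 x0 xy'.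
lra.
Qed.

Lemma derive1_lt x y : 0 < x -> 0 < y -> (derive1 u y < derive1 u x) = (x < y).
Proof.
move=> x0 y0; have [xy|yx|->] := ltgtP x y; last by rewrite ltxx.
  by rewrite derive1_decr.
by apply/negbTE; rewrite -leNgt ltW// derive1_decr.
Qed.

(* The inverse of c |-> 1 / u' c, extended by 0: for x <= 0 the set is empty, since
   u' > 0, and xget returns its default value. *)
Definition inv_marginal (x : R) : R := xget 0 [set c | 0 < c /\ derive1 u c * x = 1].

Lemma inv_marginal_ge0 x : 0 <= inv_marginal x.
Proof. by rewrite /inv_marginal; case: xgetP => // c _ [/ltW]. Qed.

Hypothesis u_inada : inada u.

Lemma inv_marginal_gt0 x : 0 < x ->
  0 < inv_marginal x /\ derive1 u (inv_marginal x) * x = 1.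
Proof.
move=> x0; rewrite /inv_marginal; case: xgetP => [c _ //|noc].
(* The default value would mean that no solution exists, but by the Inada conditions the continuous
   [u'] takes values on both sides of [x^-1]. *)
have [inf0 infy] := u_inada; exfalso.
have xi : 0 < x^-1 by rewrite invr_gt0.
have [b b1 bx] : exists2 b, 1 < b & derive1 u b < x^-1.
  have [N [_ NP]] := cvgr_lt _ inf0 _ xi.
  exists (Num.max 1 N + 1); first by rewrite ltr_pwDr// le_max lexx.
  by apply: NP; rewrite ltr_pwDr// le_max lexx orbT.
have [a /andP[a0 a1] ax] : exists2 a, 0 < a < 1 & x^-1 < derive1 u a.
  have : \forall a \near 0^'+, 0 < a < 1 /\ x^-1 < derive1 u a.
    near=> a; split; last by near: a; exact: cvgry_gt infy _.
    by apply/andP; split; near: a; [exact: nbhs_right_gt|exact: nbhs_right_lt].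
  by move=> /filter_ex[a [a01 ax]]; exists a.
have ab : a <= b by rewrite ltW// (lt_trans a1).
have cont : {within `[a, b], continuous (derive1 u)}.
  apply: continuous_in_subspaceT => c; rewrite inE/= in_itv/= => /andP[ac _].
  by have [_] := u_diff (lt_le_trans a0 ac).
have [|c cab cx] := @IVT R _ a b x^-1 ab cont.
  by rewrite ge_min le_max (ltW ax) (ltW bx) orbT.
have c0 : 0 < c by move: cab; rewrite in_itv/= => /andP[/(lt_le_trans a0)].
by apply: (noc c); split; rewrite // cx mulVf// gt_eqF.
Unshelve. all: by end_near. Qed.

Lemma inv_marginal_le0 x : x <= 0 -> inv_marginal x = 0.
Proof.
move=> x0; rewrite /inv_marginal; case: xgetP => // c _ [c0 E]; exfalso.
have := derive1_gt0 c0 => d0; have : derive1 u c * x <= 0 by rewrite pmulr_rle0.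
by rewrite E ler10.
Qed.

(** Since [u'] decreases, comparing demand with a level [c > 0] becomes a condition linear in [x].
    Continuity and measurability of demand rest on this and on [inv_marginal_lt]. *)
Lemma lt_inv_marginal c x : 0 < c -> (c < inv_marginal x) = (1 < derive1 u c * x).
Proof.
move=> c0; have [x0|x0] := leP x 0.
  rewrite inv_marginal_le0// ltNge (ltW c0); apply/esym/negbTE; rewrite -leNgt.
  by rewrite (@le_trans _ _ 0)// pmulr_rle0// derive1_gt0.
have [G0 <-] := inv_marginal_gt0 x0.
by rewrite ltr_pM2r// derive1_lt.
Qed.

Lemma inv_marginal_lt c x : 0 < c -> (inv_marginal x < c) = (derive1 u c * x < 1).
Proof.
move=> c0; have [x0|x0] := leP x 0.
  rewrite inv_marginal_le0// c0; apply/esym.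
  by rewrite (@le_lt_trans _ _ 0)// pmulr_rle0// derive1_gt0.
have [G0 <-] := inv_marginal_gt0 x0.
by rewrite ltr_pM2r// derive1_lt.
Qed.

Lemma inv_marginal_homo x y : 0 <= x -> x < y -> inv_marginal x < inv_marginal y.
Proof.
move=> x0 xy; have y0 := le_lt_trans x0 xy.
have [Gy _] := inv_marginal_gt0 y0.
have [->|xn0] := eqVneq x 0; first by rewrite inv_marginal_le0.
have x_gt0 : 0 < x by rewrite lt_neqAle eq_sym xn0.
have [Gx Ex] := inv_marginal_gt0 x_gt0.
by rewrite lt_inv_marginal// -Ex ltr_pM2l// derive1_gt0.
Qed.

Lemma inv_marginal_unbounded L : exists2 x, 0 < x & L < inv_marginal x.
Proof.
pose c := Num.max L 1; have c0 : 0 < c by rewrite lt_max ltr01 orbT.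
have d0 := derive1_gt0 c0.
exists (2 / derive1 u c); first by rewrite divr_gt0.
rewrite (@le_lt_trans _ _ c) ?le_max ?lexx// lt_inv_marginal//.
by rewrite mulrC divfK ?gt_eqF// ltr1n.
Qed.

Lemma cvg_inv_marginal (T : Type) (F : set_system T) {FF : Filter F} (f : T -> R) x :
  f @ F --> x -> inv_marginal (f t) @[t --> F] --> inv_marginal x.
Proof.
move=> fx; apply/cvgrPdist_lt => e e0.
have up : \forall t \near F, inv_marginal (f t) < inv_marginal x + e.
  have c0 : 0 < inv_marginal x + e by rewrite ltr_wpDl// inv_marginal_ge0.
  near=> t; rewrite inv_marginal_lt//; near: t.
  by apply: cvgr_lt (cvgMl_tmp fx) _ _; rewrite -inv_marginal_lt// ltrDl.
have lo : \forall t \near F, inv_marginal x - e < inv_marginal (f t).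
  have [c0|c0] := ltP 0 (inv_marginal x - e).
    near=> t; rewrite lt_inv_marginal//; near: t.
    by apply: cvgr_gt (cvgMl_tmp fx) _ _; rewrite -lt_inv_marginal// ltrBlDr ltrDl.
  have [xe|xe] := ltP (inv_marginal x - e) 0.
    by apply: nearW => t; rewrite (lt_le_trans xe)// inv_marginal_ge0.
  (* The level [inv_marginal x - e] is now 0, outside the range of [lt_inv_marginal]; the level
     [e / 2] serves instead. *)
  have xE : inv_marginal x = e by lra.
  have e2 : 0 < e / 2 by lra.
  near=> t; rewrite (@le_lt_trans _ _ (e / 2)) ?(le_trans c0) ?ltW//.
  rewrite lt_inv_marginal//; near: t.
  by apply: cvgr_gt (cvgMl_tmp fx) _ _; rewrite -lt_inv_marginal// xE; lra.
near=> t; rewrite ltr_distlC.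
by apply/andP; split; near: t.
Unshelve. all: by end_near. Qed.

End Marginal.

(** * Extended-valued utility, including consumption 0 *)

Section Utility.
Context (R : realType) (v : R -> \bar R).
Let u c := fine (v c).
Hypotheses (v_fin : forall c : R, 0 < c -> v c \is a fin_num)
  (u_inc : strictly_increasing_pos u) (u_conc : strictly_concave_pos u)
  (u_diff : continuously_differentiable_pos u)
  (v0 : v c @[c --> 0^'+] --> v 0).

Lemma utility_EFin c : 0 < c -> v c = (u c)%:E.
Proof. by move=> c0; rewrite /u fineK// v_fin. Qed.

Lemma utility_le x y : 0 <= x -> x <= y -> (v x <= v y)%E.
Proof.
move=> x0; rewrite le_eqVlt => /orP[/eqP ->//|xy].
have [{}x0|x0'] : 0 < x \/ x = 0.
  by move: x0; rewrite le_eqVlt => /orP[/eqP ->|]; [right|left].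
  by rewrite (utility_EFin x0) (utility_EFin (lt_trans x0 xy)) lee_fin ltW// u_inc.
rewrite x0' in xy *; apply: cvge_to_le v0 _; near=> c.
have c0 : 0 < c by near: c; exact: nbhs_right_gt.
have cy : c < y by near: c; exact: nbhs_right_lt.
by rewrite (utility_EFin c0) (utility_EFin (lt_trans c0 cy)) lee_fin ltW// u_inc.
Unshelve. all: by end_near. Qed.

Lemma utility_right_cvg x : 0 <= x -> v c @[c --> x^'+] --> v x.
Proof.
rewrite le_eqVlt => /orP[/eqP <-//|x0].
have [du _] := u_diff x0.
have ux : u c @[c --> x^'+] --> u x.
  apply: cvg_at_right_filter.
  by move: du => /derivable1_diffP/differentiable_continuous.
rewrite utility_EFin//; apply/fine_cvgP; split=> //; near=> c.
by rewrite v_fin// (lt_trans x0)//; near: c; exact: nbhs_right_gt.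
Unshelve. all: by end_near. Qed.

(** For [y = 0], possibly with value [-oo], passing to the limit would lose strictness. The bound
    goes through [x / 2] instead, where the tangent is strictly steeper. *)
Lemma utility_tangent_lt x y : 0 < x -> 0 <= y -> y != x ->
  (v y < (u x + derive1 u x * (y - x))%:E)%E.
Proof.
move=> x0; rewrite le_eqVlt => /orP[/eqP <- _|y0 yx]; last first.
  by rewrite utility_EFin// lte_fin; exact: tangent_lt.
pose z := x / 2; have z0 : 0 < z by rewrite /z; lra.
have zx : z < x by rewrite /z; lra.
have dz0 := derive1_gt0 u_inc u_conc u_diff z0.
have dzx := derive1_decr u_conc u_diff z0 zx.
have dx0 := derive1_gt0 u_inc u_conc u_diff x0.
(* Chosen so that [(1 - e) * u' z] is the mean of [u' z] and [u' x], still larger than [u' x]; [v 0]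
   is then bounded by [v (z * e)]. *)
pose e := (1 - derive1 u x / derive1 u z) / 2.
have e01 : 0 < e < 1.
  rewrite /e; have : 0 < derive1 u x / derive1 u z by rewrite divr_gt0.
  have : derive1 u x / derive1 u z < 1 by rewrite ltr_pdivrMr// mul1r.
  lra.
have y0 : 0 < z * e by case/andP: e01 => e0 _; rewrite mulr_gt0.
rewrite (le_lt_trans (utility_le (lexx 0) (ltW y0)))// utility_EFin// lte_fin.
have zn : z != x by rewrite lt_eqF.
have := tangent_le u_conc u_diff z0 y0; have := tangent_lt u_conc u_diff x0 z0 zn.
have : derive1 u z * (z * e - z) = - (z * (derive1 u z + derive1 u x) / 2).
  by rewrite /e; field; rewrite gt_eqF.
have : derive1 u x * z < derive1 u z * z by rewrite ltr_pM2r.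
have -> : x = z *+ 2 by rewrite /z; field.
lra.
Qed.

End Utility.

(** * Measurability of demand and of the utility of random consumption *)

Section Measurability.
Context (R : realType) (d : measure_display) (S : measurableType d).

Lemma measurable_fun_of_gt (f : S -> R) :
  (forall a, measurable [set s | a < f s]) -> measurable_fun setT f.
Proof.
move=> mf mD; apply: (measurability _ (RGenOInfty.measurableE R)) => //.
by move=> /= _ [_ [a ->] <-]; rewrite preimage_itvoy setTI.
Qed.

Lemma emeasurable_fun_of_lt (f : S -> \bar R) :
  (forall a : R, measurable [set s | (f s < a%:E)%E]) -> measurable_fun setT f.
Proof.
move=> mf mD; apply: (measurability _ (ErealGenInftyO.measurableE R)) => //.
by move=> /= _ [_ [a ->] <-]; rewrite preimage_itvNyo setTI.
Qed.

Lemma measurable_gt (f : S -> R) a :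
  measurable_fun setT f -> measurable [set s | a < f s].
Proof. by move=> mf; rewrite -[X in measurable X]setTI -preimage_itvoy; exact: mf. Qed.

Lemma measurable_lt (f : S -> R) a :
  measurable_fun setT f -> measurable [set s | f s < a].
Proof. by move=> mf; rewrite -[X in measurable X]setTI -preimage_itvNyo; exact: mf. Qed.

Lemma measurable_funV_ge0 (f : S -> R) : (forall s, 0 <= f s) ->
  measurable_fun setT f -> measurable_fun setT (fun s => (f s)^-1).
Proof.
move=> f0 mf; apply: measurable_fun_of_gt => a.
have [a0|a0] := ltP a 0.
  rewrite (_ : [set _ | _] = setT); first exact: measurableT.
  by apply/seteqP; split=> // s _ /=; rewrite (lt_le_trans a0)// invr_ge0.
have [->|an0] := eqVneq a 0.
  rewrite (_ : [set _ | _] = [set s | 0 < f s]); last first.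
    by apply/seteqP; split=> s /=; rewrite invr_gt0.
  exact: measurable_gt.
have {}a0 : 0 < a by rewrite lt_neqAle eq_sym an0.
(* As [0^-1 = 0], the level set for [a > 0] excludes the zeros of [f]. *)
rewrite (_ : [set _ | _] = [set s | 0 < f s] `&` [set s | f s < a^-1]).
  by apply: measurableI; [exact: measurable_gt|exact: measurable_lt].
apply/seteqP; split => s /=.
  move=> afs; have fs : 0 < f s by rewrite -invr_gt0 (lt_trans a0).
  by split => //; rewrite -[f s]invrK ltf_pV2 ?posrE ?invr_gt0.
by move=> [fs fa]; rewrite -[a]invrK ltf_pV2 ?posrE ?invr_gt0.
Qed.

Context (U : R -> S -> \bar R).
Hypotheses (U_field : measurable_field U) (U_util : utility_assumption U).

Definition marginal (s : S) (c : R) : R := derive1 (fun c => fine (U c s)) c.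

Lemma measurable_marginal c : 0 < c -> measurable_fun setT (marginal ^~ c).
Proof.
move=> c0.
apply: (@measurable_fun_cvg _ _ _ _
  (fun n s => n.+1%:R * (fine (U (n.+1%:R^-1 + c) s) - fine (U c s)))).
  move=> n; apply: measurable_funM; first exact: measurable_cst.
  have mU x : 0 <= x -> measurable_fun setT (fun s => fine (U x s)).
    by move=> x0; apply: measurableT_comp => //; exact: (U_field x0).1.
  by apply: measurable_funB; apply: mU; rewrite ?ltW// addr_gt0// invr_gt0.
move=> s _; have [_ _ _ [u_diff _] _] := U_util s.
exact: (derive1_seq u_diff).
Qed.

Definition demand (s : S) (x : R) : R := inv_marginal (fun c => fine (U c s)) x.

Lemma measurable_demand (x : S -> R) :
  measurable_fun setT x -> measurable_fun setT (fun s => demand s (x s)).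
Proof.
move=> mx; apply: measurable_fun_of_gt => a.
have demand_gt s c : 0 < c -> (c < demand s (x s)) = (1 < marginal s c * x s).
  move=> c0; have [_ u_inc u_conc [u_diff u_inada] _] := U_util s.
  exact: lt_inv_marginal.
have mgt c : 0 < c -> measurable [set s | c < demand s (x s)].
  move=> c0; rewrite (_ : [set _ | _] = [set s | 1 < marginal s c * x s]).
    by apply/measurable_gt/measurable_funM => //; exact: measurable_marginal.
  by apply/seteqP; split => s /=; rewrite demand_gt.
have [a0|a0] := ltP a 0.
  rewrite (_ : [set _ | _] = setT); first exact: measurableT.
  by apply/seteqP; split=> // s _ /=; rewrite (lt_le_trans a0)// /demand inv_marginal_ge0.
(* Approximating [a] from above keeps the levels positive, also when [a = 0]. *)
rewrite (_ : [set _ | _] = \bigcup_n [set s | a + n.+1%:R^-1 < demand s (x s)]).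
  by apply: bigcupT_measurable => n; apply: mgt; rewrite ltr_wpDl// invr_gt0.
apply/seteqP; split => s /=.
  by move=> /ltr_add_invr[n an]; exists n.
by move=> [n _ /=]; apply: lt_trans; rewrite ltrDl invr_gt0.
Qed.

(** By monotonicity and right continuity in consumption, [U (a s) s < b] holds iff [U q s < b] for
    some rational [q > a s], which involves only constant consumption levels. *)
Lemma measurable_field_comp (a : S -> R) :
  L0_plus a -> measurable_fun setT (field_comp U a).
Proof.
move=> [ma a0]; apply: emeasurable_fun_of_lt => b.
(* The maximum with 0 keeps the level in the domain of the field; a negative [q] contributes the
   empty set. *)
rewrite (_ : [set _ | _] = \bigcup_(q : rat)
    ([set s | a s < ratr q] `&` [set s | (U (Num.max 0 (ratr q))%R s < b%:E)%E])).
  apply: bigcupT_measurable_rat => q; apply: measurableI; first exact: measurable_lt.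
  rewrite -[X in measurable X]setTI; apply: emeasurable_fun_infty_o => //.
  by apply: (U_field _).1; rewrite le_max lexx.
apply/seteqP; split => s /=; have [v_fin u_inc u_conc [u_diff u_inada] v0] := U_util s.
  rewrite /field_comp => Ub.
  have : \forall c \near (a s)^'+, (U c s < b%:E)%E.
    have vP := utility_right_cvg v_fin u_diff v0 (a0 s).
    exact: (vP [set y | (y < b%:E)%E] (open_ereal_lt' Ub)).
  rewrite near_withinE => -[e /= e0 eP].
  have /rat_in_itvoo[q] : a s < a s + e by rewrite ltrDl.
  rewrite in_itv /= => /andP[aq qe]; exists q => //=; split => //.
  rewrite max_r; last by rewrite (le_trans (a0 s))// ltW.
  by apply: eP => //=; rewrite ltr_distlC; apply/andP; split; lra.
move=> [q _ /= [aq]]; apply: le_lt_trans.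
apply: (utility_le v_fin u_inc v0) => //.
by rewrite le_max (ltW aq) orbT.
Qed.

End Measurability.

(** * Pareto optimal allocations *)

Section Clearing.
Context (R : realType) (M : nat) (u : 'I_M -> R -> R).
Hypotheses (u_inc : forall m, strictly_increasing_pos (u m))
  (u_conc : forall m, strictly_concave_pos (u m))
  (u_diff : forall m, continuously_differentiable_pos (u m))
  (u_inada : forall m, inada (u m)).
Implicit Types (w : 'I_M -> R) (x L : R).

(** Total Pareto consumption when the resource constraint has multiplier [1 / x]. *)
Definition aggregate w x := \sum_m inv_marginal (u m) (w m * x).

Lemma aggregate0 w : aggregate w 0 = 0.
Proof. by rewrite /aggregate big1// => m _; rewrite mulr0 inv_marginal_le0. Qed.

Lemma simplex_gt0 w : simplex w -> exists m, 0 < w m.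
Proof.
move=> [w0 w1]; apply/existsP; apply: contraT => /existsPn w_le0.
suff : \sum_i w i = 0 by rewrite w1 => /eqP; rewrite oner_eq0.
by apply: big1 => i _; apply/eqP; rewrite eq_le w0 leNgt w_le0.
Qed.

Lemma inv_marginal_le m x y : x <= y -> inv_marginal (u m) x <= inv_marginal (u m) y.
Proof.
have [x0|x0] := leP x 0; first by rewrite (inv_marginal_le0 _ _ _ x0)// inv_marginal_ge0.
rewrite le_eqVlt => /orP[/eqP ->//|xy].
by rewrite ltW// inv_marginal_homo// ltW.
Qed.

Lemma aggregate_lt w x y : simplex w -> 0 <= x -> x < y -> aggregate w x < aggregate w y.
Proof.
move=> wS x0 xy; have [m wm] := simplex_gt0 wS.
rewrite /aggregate (bigD1 m)//= [ltRHS](bigD1 m)//=; apply: ltr_leD.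
  by apply: inv_marginal_homo => //; rewrite ?ltr_pM2l// mulr_ge0// ltW.
by apply: ler_sum => i _; apply: inv_marginal_le; rewrite ler_wpM2l ?(ltW xy)// wS.1.
Qed.

Lemma aggregate_ltE w x y : simplex w -> 0 <= x -> 0 <= y ->
  (aggregate w x < aggregate w y) = (x < y).
Proof.
move=> wS x0 y0; have [xy|yx|->] := ltgtP x y; last by rewrite ltxx.
  by rewrite aggregate_lt.
by apply/negbTE; rewrite -leNgt ltW// aggregate_lt.
Qed.

Lemma cvg_aggregate (T : Type) (F : set_system T) {FF : Filter F}
    (v : T -> 'I_M -> R) (f : T -> R) w x :
  (forall m, v t m @[t --> F] --> w m) -> f @ F --> x ->
  aggregate (v t) (f t) @[t --> F] --> aggregate w x.
Proof.
move=> vw fx; apply: cvg_big => [|m _]; first exact: add_continuous.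
by apply: cvg_inv_marginal => //; apply: cvgM.
Qed.

Lemma aggregate_unbounded w L : simplex w -> exists2 x, 0 < x & L < aggregate w x.
Proof.
move=> wS; have [m wm] := simplex_gt0 wS.
have [y y0 Ly] := inv_marginal_unbounded (u_inc m) (u_conc m) (u_diff m) (u_inada m) L.
exists (y / w m); first by rewrite divr_gt0.
rewrite (lt_le_trans Ly)// /aggregate (bigD1 m)//= mulrC divfK ?gt_eqF//.
by rewrite lerDl sumr_ge0// => i _; exact: inv_marginal_ge0.
Qed.

Definition clearing w L := xget 0 [set x | 0 <= x /\ aggregate w x = L].

Lemma clearing_ge0 w L : 0 <= clearing w L.
Proof. by rewrite /clearing; case: xgetP => // x _ []. Qed.

Lemma aggregate_clearing w L : simplex w -> 0 <= L -> aggregate w (clearing w L) = L.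
Proof.
move=> wS L0; rewrite /clearing; case: xgetP => [x _ []//|nox]; exfalso.
have [b b0 Lb] := aggregate_unbounded L wS.
have cont : {within `[0, b], continuous (aggregate w)}.
  apply: continuous_subspaceT => x; apply: cvg_aggregate => [m|]; first exact: cvg_cst.
  exact: cvg_id.
have [|c cab cx] := @IVT R _ 0 b L (ltW b0) cont.
  by rewrite aggregate0 ge_min le_max L0 (ltW Lb) orbT.
by apply: (nox c); split=> //; move: cab; rewrite in_itv/= => /andP[].
Qed.

Lemma lt_clearing w L x : simplex w -> 0 <= L -> 0 <= x ->
  (x < clearing w L) = (aggregate w x < L).
Proof.
by move=> wS L0 x0; rewrite -{2}(aggregate_clearing wS L0) aggregate_ltE// clearing_ge0.
Qed.

Lemma clearing_lt w L x : simplex w -> 0 <= L -> 0 <= x ->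
  (clearing w L < x) = (L < aggregate w x).
Proof.
by move=> wS L0 x0; rewrite -{2}(aggregate_clearing wS L0) aggregate_ltE// clearing_ge0.
Qed.

Lemma clearing_gt0 w L : simplex w -> 0 < L -> 0 < clearing w L.
Proof. by move=> wS L0; rewrite lt_clearing ?aggregate0// ltW. Qed.

(** By [lt_clearing] and [clearing_lt], enclosing the solution between [X - e] and [X + e] only
    requires convergence of [aggregate] at these two fixed points. *)
Lemma cvg_clearing (v : nat -> 'I_M -> R) w L : (forall n, simplex (v n)) ->
  simplex w -> ptw_cvg v w -> 0 <= L -> clearing (v n) L @[n --> \oo] --> clearing w L.
Proof.
move=> vS wS vw L0; apply/cvgrPdist_lt => e e0.
have X0 := clearing_ge0 w L; set X := clearing w L in X0 *.
have agg x : aggregate (v n) x @[n --> \oo] --> aggregate w x.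
  by apply: cvg_aggregate => //; exact: cvg_cst.
have up : \forall n \near \oo, clearing (v n) L < X + e.
  have Xe : 0 <= X + e by rewrite addr_ge0// ltW.
  near=> n; rewrite clearing_lt//; near: n.
  by apply: cvgr_gt (agg _) _ _; rewrite -clearing_lt// ltrDl.
have lo : \forall n \near \oo, X - e < clearing (v n) L.
  have [Xe|Xe] := leP 0 (X - e).
    near=> n; rewrite lt_clearing//; near: n.
    by apply: cvgr_lt (agg _) _ _; rewrite -lt_clearing// ltrBlDr ltrDl.
  by apply: nearW => n; rewrite (lt_le_trans Xe)// clearing_ge0.
near=> n; rewrite ltr_distlC.
by apply/andP; split; near: n.
Unshelve. all: by end_near. Qed.

(** An agent [m] with at least the share [L / M] satisfies [1 <= u' (L / M) * (w m * X)], with [X]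
    the clearing value, and [w m <= 1]. Summing over all agents makes the bound uniform in [w]. *)
Lemma clearing_price_le w L : simplex w -> 0 < L ->
  (clearing w L)^-1 <= \sum_m derive1 (u m) (L / M%:R).
Proof.
move=> wS L0; have X0 := clearing_gt0 wS L0.
have [m0 _] := simplex_gt0 wS.
have M0 : 0 < M%:R :> R by rewrite ltr0n (leq_trans _ (ltn_ord m0)).
have LM : 0 < L / M%:R by rewrite divr_gt0.
have [m Gm] : exists m, L / M%:R <= inv_marginal (u m) (w m * clearing w L).
  apply/existsP; apply: contraT => /existsPn lt_LM.
  have := aggregate_clearing wS (ltW L0).
  suff : aggregate w (clearing w L) < L by move=> /lt_eqF/eqP.
  have {2}-> : L = \sum_(m < M) L / M%:R.
    by rewrite sumr_const card_ord -[RHS]mulr_natr divfK// gt_eqF.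
  apply: ltr_sum; last by move=> i _; rewrite ltNge lt_LM.
  by apply/hasP; exists m0; rewrite ?mem_index_enum.
rewrite (@le_trans _ _ (derive1 (u m) (L / M%:R)))//; last first.
  rewrite (bigD1 m)//= lerDl sumr_ge0// => i _.
  by rewrite ltW//; apply: derive1_gt0.
move: Gm; rewrite leNgt inv_marginal_lt// -leNgt => le1.
have d0 := derive1_gt0 (u_inc m) (u_conc m) (u_diff m) LM.
rewrite -[_^-1]mul1r ler_pdivrMr//; apply: (le_trans le1).
by rewrite ler_pM2l// ger_pMl// simplex_le1.
Qed.

End Clearing.

(** * Almost everywhere comparison of integrals *)

Section Integration.
Context (R : realType) (d : measure_display) (S : measurableType d)
  (mu : {measure set S -> \bar R}).
Implicit Types f g : S -> \bar R.
Local Open Scope ereal_scope.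

Lemma integrable_of_fin f : measurable_fun setT f ->
  \int[mu]_s f s \is a fin_num -> mu.-integrable setT f.
Proof.
move=> mf fin; apply/integrableP; split=> //.
by apply/abse_integralP => //; rewrite -fin_num_abs.
Qed.

Lemma ae_le_integrable f g : measurable_fun setT f -> mu.-integrable setT g ->
  {ae mu, forall s, `|f s| <= g s} -> mu.-integrable setT f.
Proof.
move=> mf gi fg; apply/integrableP; split=> //.
have /integrableP[mg] := gi; apply: le_lt_trans; apply: ae_ge0_le_integral => //.
- exact: measurableT_comp.
- exact: measurableT_comp.
- by apply: filterS fg => s fgs _; rewrite (le_trans fgs)// lee_abs.
Qed.

(** Serves consumption plans whose utility may integrate to [-oo]: the positive part grows, the
    negative part shrinks, and subtraction in [\bar R] respects this. *)
Lemma ae_le_integral f g : measurable_fun setT f -> measurable_fun setT g ->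
  {ae mu, forall s, f s <= g s} -> \int[mu]_s f s <= \int[mu]_s g s.
Proof.
move=> mf mg fg; rewrite integralE [leRHS]integralE.
apply: leeB; apply: ae_ge0_le_integral => //.
- exact: measurable_funepos.
- exact: measurable_funepos.
- apply: filterS fg => s fgs _.
  by rewrite !funeposE ge_max !le_max lexx fgs orbT.
- exact: measurable_funeneg.
- exact: measurable_funeneg.
- apply: filterS fg => s fgs _.
  by rewrite !funenegE ge_max !le_max lexx leeN2 fgs orbT.
Qed.

(** Equality of the integrals makes [f] integrable too; then the nonnegative [g - f] has integral
    0. *)
Lemma ae_eq_of_integral_eq f g : measurable_fun setT f -> mu.-integrable setT g ->
  {ae mu, forall s, f s <= g s} -> \int[mu]_s f s = \int[mu]_s g s ->
  {ae mu, forall s, f s = g s}.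
Proof.
move=> mf gi fg eq_int.
have g_fin := integrable_fin_num (@measurableT _ S) gi.
have fi : mu.-integrable setT f by apply: integrable_of_fin => //; rewrite eq_int.
have hi : mu.-integrable setT (g \- f) by exact: integrableB.
have mh := measurable_int _ hi.
have h0 : \int[mu]_s `|g s - f s| = 0.
  rewrite (ae_eq_integral (g \- f))//; [|exact: measurableT_comp|].
    by rewrite integralB// eq_int subee.
  apply: filterS2 fg (integrable_ae (@measurableT _ S) fi) => s fgs /(_ I) ffin _ /=.
  by rewrite gee0_abs// sube_ge0// ffin.
have /ae_eq_integral_abs := h0; move=> /(_ measurableT mh) ae0.
have := integrable_ae measurableT fi; have := integrable_ae measurableT gi.
move: ae0; apply: filterS3 => s /(_ I) /= h_eq /(_ I) gfin /(_ I) ffin.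
by move: h_eq; rewrite -(fineK gfin) -(fineK ffin) -EFinB => -[/subr0_eq ->].
Qed.

End Integration.

(** * Equilibrium *)

Section Economy.
Context (R : realType) (d : measure_display) (S : measurableType d)
  (mu : {sigma_finite_measure set S -> \bar R}) (M : nat) (U : 'I_M -> R -> S -> \bar R)
  (Lambda : S -> R) (alpha0 : 'I_M -> S -> R).
Hypotheses (M_gt0 : (0 < M)%N)
  (U_field : forall m, measurable_field (U m))
  (U_utility : forall m, utility_assumption (U m))
  (Lambda_L0 : L0_plus Lambda)
  (Lambda_gt0 : {ae mu, forall s, 0 < Lambda s})
  (alpha0_alloc : allocation mu Lambda alpha0)
  (alpha0_neq0 : forall m, ~ {ae mu, forall s, alpha0 m s = 0})
  (U_integrable : forall (t : R) (m : 'I_M), 0 < t -> t <= 1 ->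
    (\int[mu]_s `|field_comp (U m) (fun s' => (t * Lambda s')%R) s| < +oo)%E).
Implicit Types (w : 'I_M -> R) (m : 'I_M) (s : S).

Let u s m c := fine (U m c s).

Let u_inc s m : strictly_increasing_pos (u s m).
Proof. by have [] := U_utility m s. Qed.

Let u_conc s m : strictly_concave_pos (u s m).
Proof. by have [] := U_utility m s. Qed.

Let u_diff s m : continuously_differentiable_pos (u s m).
Proof. by have [_ _ _ []] := U_utility m s. Qed.

Let u_inada s m : inada (u s m).
Proof. by have [_ _ _ []] := U_utility m s. Qed.

Let U_fin s m c : 0 < c -> U m c s \is a fin_num.
Proof. by have [+ _ _ _ _] := U_utility m s; apply. Qed.

Let U_cvg0 s m : U m c s @[c --> 0^'+] --> U m 0 s.
Proof. by have [] := U_utility m s. Qed.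

Let UE s m c : 0 < c -> U m c s = (u s m c)%:E.
Proof. by move=> c0; exact: (utility_EFin (v := U m ^~ s) (@U_fin s m)). Qed.

Let Lambda_ge0 s : 0 <= Lambda s.
Proof. by case: Lambda_L0. Qed.

(* The reciprocal of the Lagrange multiplier of the resource constraint at s.  On
   the null set where Lambda vanishes it is 0, and so is price. *)
Definition inv_price w s := clearing (u s) w (Lambda s).

Definition price w s := (inv_price w s)^-1.

Definition pareto w m s := inv_marginal (u s m) (w m * inv_price w s).

Definition excess w m s := price w s * (pareto w m s - alpha0 m s).

Lemma inv_price_ge0 w s : 0 <= inv_price w s.
Proof. exact: clearing_ge0. Qed.

Lemma inv_price_gt0 w s : simplex w -> 0 < Lambda s -> 0 < inv_price w s.
Proof. by move=> wS L0; exact: clearing_gt0. Qed.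

Lemma price_ge0 w s : 0 <= price w s.
Proof. by rewrite invr_ge0 inv_price_ge0. Qed.

Lemma pareto_ge0 w m s : 0 <= pareto w m s.
Proof. exact: inv_marginal_ge0. Qed.

Lemma sum_pareto w s : simplex w -> \sum_m pareto w m s = Lambda s.
Proof. by move=> wS; exact: aggregate_clearing. Qed.

Lemma pareto_le w m s : simplex w -> pareto w m s <= Lambda s.
Proof.
move=> wS; rewrite -(sum_pareto s wS) (bigD1 m)//= lerDl.
by apply: sumr_ge0 => i _; exact: pareto_ge0.
Qed.

Lemma alpha0_ge0 m s : 0 <= alpha0 m s.
Proof. by have [/(_ m)[]] := alpha0_alloc. Qed.

(** The set of full measure on which the pointwise estimates are made. *)
Definition regular s := 0 < Lambda s /\ \sum_m alpha0 m s = Lambda s.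

Lemma ae_regular : {ae mu, forall s, regular s}.
Proof. by have [_] := alpha0_alloc; exact: filterS2 Lambda_gt0. Qed.

Lemma alpha0_le m s : regular s -> alpha0 m s <= Lambda s.
Proof.
move=> [_ <-]; rewrite (bigD1 m)//= lerDl.
by apply: sumr_ge0 => i _; exact: alpha0_ge0.
Qed.

Lemma measurable_inv_price w : simplex w -> measurable_fun setT (inv_price w).
Proof.
move=> wS; apply: measurable_fun_of_gt => a.
have [a0|a0] := ltP a 0.
  rewrite (_ : [set _ | _] = setT); first exact: measurableT.
  by apply/seteqP; split=> // s _ /=; rewrite (lt_le_trans a0)// inv_price_ge0.
(* [lt_clearing] replaces the implicit solution by total demand at the fixed level [a]. *)
rewrite (_ : [set _ | _] = [set s | aggregate (u s) w a - Lambda s < 0]).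
  apply/measurable_lt/measurable_funB; last by case: Lambda_L0.
  apply: measurable_sum => m.
  by apply: measurable_demand => //; exact: measurable_cst.
by apply/seteqP; split => s /=; rewrite /inv_price lt_clearing// subr_lt0.
Qed.

Lemma measurable_price w : simplex w -> measurable_fun setT (price w).
Proof.
move=> wS; apply: measurable_funV_ge0; first exact: inv_price_ge0.
exact: measurable_inv_price.
Qed.

Lemma measurable_pareto w m : simplex w -> measurable_fun setT (pareto w m).
Proof.
move=> wS; apply: measurable_demand => //; apply: measurable_funM => //.
exact: measurable_inv_price.
Qed.

Lemma measurable_excess w m : simplex w -> measurable_fun setT (excess w m).
Proof.
move=> wS; apply: measurable_funM; first exact: measurable_price.
apply: measurable_funB; first exact: measurable_pareto.
by have [/(_ m)[]] := alpha0_alloc.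
Qed.

(* Each term dominates U_m'(Lambda / M) Lambda, by concavity between Lambda / (2M)
   and Lambda / M. *)
Definition value_bound s : \bar R := (\sum_(m < M) (2 * M%:R)%:E *
  (field_comp (U m) (fun s => M%:R^-1 * Lambda s)%R s -
   field_comp (U m) (fun s => M%:R^-1 / 2 * Lambda s)%R s))%E.

Lemma L0_plus_scale t : 0 <= t -> L0_plus (fun s => t * Lambda s).
Proof.
move=> t0; have [mL L0] := Lambda_L0; split=> [|s]; last by rewrite mulr_ge0.
by apply: measurable_funM => //; exact: measurable_cst.
Qed.

Lemma integrable_scale t m : 0 < t -> t <= 1 ->
  mu.-integrable setT (field_comp (U m) (fun s => t * Lambda s)).
Proof.
move=> t0 t1; apply/integrableP; split; last exact: U_integrable.
by apply: measurable_field_comp => //; apply: L0_plus_scale; exact: ltW.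
Qed.

Lemma integrable_value_bound : mu.-integrable setT value_bound.
Proof.
have M0 : 0 < M%:R^-1 :> R by rewrite invr_gt0 ltr0n.
have M1 : M%:R^-1 <= 1 :> R by rewrite invf_le1 ?ltr0n// ler1n.
apply: integrable_sum => // m _; apply: integrableZl => //.
by apply: integrableB => //; apply: integrable_scale => //; lra.
Qed.

Lemma price_Lambda_le w s : simplex w -> 0 < Lambda s ->
  ((price w s * Lambda s)%:E <= value_bound s)%E.
Proof.
move=> wS L0; have M0 : 0 < M%:R :> R by rewrite ltr0n.
have Mn0 : M%:R != 0 :> R by rewrite gt_eqF.
have iM0 : 0 < M%:R^-1 :> R by rewrite invr_gt0.
pose x := M%:R^-1 * Lambda s; pose y := M%:R^-1 / 2 * Lambda s.
have x0 : 0 < x by rewrite mulr_gt0.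
have y0 : 0 < y by rewrite mulr_gt0// divr_gt0.
rewrite /value_bound (eq_bigr (fun m => (2 * M%:R * (u s m x - u s m y))%:E)); last first.
  by move=> m _; rewrite /field_comp -/x -/y (UE s m x0) (UE s m y0) -EFinB -EFinM.
rewrite sumEFin lee_fin.
have : price w s <= \sum_m derive1 (u s m) (Lambda s / M%:R) by exact: clearing_price_le.
move=> /(ler_wpM2r (ltW L0))/le_trans; apply; rewrite mulr_suml ler_sum// => m _.
rewrite [Lambda s / _]mulrC -/x.
have := tangent_le (@u_conc s m) (@u_diff s m) x0 y0.
(* The gap [Lambda / (2M)] accounts for the factor [2M] in [value_bound]. *)
have -> : y - x = - (Lambda s / (2 * M%:R)) by rewrite /x /y; field.
have -> : derive1 (u s m) x * Lambda s =
    2 * M%:R * (derive1 (u s m) x * (Lambda s / (2 * M%:R))) by field.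
by rewrite ler_pM2l ?mulr_gt0//; lra.
Qed.

(** Both consumptions lie between 0 and [Lambda s]. *)
Lemma excess_le w m s : simplex w -> regular s ->
  `|excess w m s| <= price w s * Lambda s.
Proof.
move=> wS sreg; rewrite /excess normrM (ger0_norm (price_ge0 w s)).
rewrite ler_wpM2l ?price_ge0// ler_norml.
have := pareto_ge0 w m s; have := pareto_le m s wS; have := alpha0_ge0 m s.
have := alpha0_le m sreg; lra.
Qed.

Lemma ae_excess_le w m : simplex w ->
  {ae mu, forall s, (`|(excess w m s)%:E| <= value_bound s)%E}.
Proof.
move=> wS; apply: filterS ae_regular => s sreg; have [L0 _] := sreg.
by apply: le_trans (price_Lambda_le wS L0); rewrite lee_fin excess_le.
Qed.

Lemma integrable_excess w m : simplex w -> mu.-integrable setT (EFin \o excess w m).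
Proof.
move=> wS; apply: ae_le_integrable integrable_value_bound (ae_excess_le m wS).
by apply: measurableT_comp => //; exact: measurable_excess.
Qed.

Lemma integrable_price_Lambda w : simplex w ->
  mu.-integrable setT (fun s => (price w s * Lambda s)%:E).
Proof.
move=> wS; apply: ae_le_integrable integrable_value_bound _.
  apply: measurableT_comp => //; apply: measurable_funM; first exact: measurable_price.
  by case: Lambda_L0.
apply: filterS ae_regular => s [L0 _]; rewrite /= ger0_norm.
  exact: price_Lambda_le.
by rewrite mulr_ge0// price_ge0.
Qed.

Definition mean_excess w m : \bar R := (\int[mu]_s (excess w m s)%:E)%E.

Lemma mean_excess_fin w m : simplex w -> mean_excess w m \is a fin_num.
Proof. by move=> wS; exact: integrable_fin_num (integrable_excess m wS). Qed.

Lemma cvg_excess (v : nat -> 'I_M -> R) w m s : (forall n, simplex (v n)) ->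
  simplex w -> ptw_cvg v w -> 0 < Lambda s ->
  excess (v n) m s @[n --> \oo] --> excess w m s.
Proof.
move=> vS wS vw L0.
have Xcvg : inv_price (v n) s @[n --> \oo] --> inv_price w s.
  by apply: cvg_clearing => //.
apply: cvgM; first by apply: cvgV => //; rewrite gt_eqF// inv_price_gt0.
apply: cvgB; last exact: cvg_cst.
by apply: cvg_inv_marginal => //; apply: cvgM.
Qed.

Lemma cvg_mean_excess (v : nat -> 'I_M -> R) w m : (forall n, simplex (v n)) ->
  simplex w -> ptw_cvg v w -> mean_excess (v n) m @[n --> \oo] --> mean_excess w m.
Proof.
move=> vS wS vw.
have [|||||_ _] := @dominated_convergence _ S R mu setT measurableT
  (fun n s => (excess (v n) m s)%:E) (fun s => (excess w m s)%:E) value_bound.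
- by move=> n; apply: measurableT_comp => //; exact: measurable_excess.
- by apply: measurableT_comp => //; exact: measurable_excess.
- apply: filterS ae_regular => s [L0 _] _.
  by apply: cvg_EFin; [exact: nearW|exact: cvg_excess].
- exact: integrable_value_bound.
- apply: filterS ae_regular => s sreg n _; have [L0 _] := sreg.
  by apply: le_trans (price_Lambda_le (vS n) L0); rewrite lee_fin excess_le.
- exact: id.
Qed.

(** Walras' law: both allocations sum to [Lambda]. *)
Lemma sum_mean_excess w : simplex w -> (\sum_m mean_excess w m = 0)%E.
Proof.
move=> wS; rewrite /mean_excess -integral_sum//; last first.
  by move=> m; exact: integrable_excess.
rewrite -[RHS](@integral0 _ S R mu setT); apply: ae_eq_integral => //.
  by apply: emeasurable_sum => m; apply: measurableT_comp => //; exact: measurable_excess.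
apply: filterS ae_regular => s [_ sum0] _.
by rewrite sumEFin -mulr_sumr sumrB sum_pareto// sum0 subrr mulr0.
Qed.

(** An agent of weight 0 consumes nothing and sells a nonzero endowment at positive prices. *)
Lemma mean_excess_lt0 w m : simplex w -> w m = 0 -> (mean_excess w m < 0)%E.
Proof.
move=> wS wm; have excessE s : excess w m s = - (price w s * alpha0 m s).
  by rewrite /excess /pareto wm mul0r inv_marginal_le0// sub0r mulrN.
have le0 s : excess w m s <= 0.
  by rewrite excessE oppr_le0 mulr_ge0 ?price_ge0 ?alpha0_ge0.
rewrite lt_neqAle; apply/andP; split; last first.
  rewrite -(@integral0 _ S R mu setT); apply: ae_le_integral => //.
    by apply: measurableT_comp => //; exact: measurable_excess.
  by apply: aeW => s; rewrite lee_fin.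
apply/eqP => int0; apply: (@alpha0_neq0 m).
have : {ae mu, forall s, (excess w m s)%:E = 0%E}.
  apply: (@ae_eq_of_integral_eq _ _ _ mu _ (cst 0%E)).
  - by apply: measurableT_comp => //; exact: measurable_excess.
  - exact: integrable0.
  - by apply: aeW => s; rewrite lee_fin.
  - by rewrite integral0; exact: int0.
apply: filterS2 ae_regular => s [L0 _] [/eqP].
rewrite excessE oppr_eq0 mulf_eq0 invr_eq0 gt_eqF/= ?inv_price_gt0//.
by move=> /eqP.
Qed.

Lemma sum_fine_mean_excess w : simplex w -> \sum_m fine (mean_excess w m) = 0.
Proof.
move=> wS; apply: EFin_inj; rewrite -sumEFin -[RHS](sum_mean_excess wS).
by apply: eq_bigr => m _; rewrite fineK// mean_excess_fin.
Qed.

(** KKM for the sets where the mean excess of [m] is at most 0: dominated convergence closes them,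
    Walras' law makes them cover the simplex, and [mean_excess_lt0] gives the face condition. *)
Lemma equilibrium_weights : exists w, [/\ simplex w, forall m, 0 < w m &
  forall m, mean_excess w m = 0%E].
Proof.
have [|||w wS w_le0] := @kkm R M (fun m => [set w | simplex w /\ (mean_excess w m <= 0)%E]) M_gt0.
- move=> m v w vS vw vA; have wS := simplex_ptw_closed vS vw.
  split=> //; apply: (cvge_to_le (f := fun n => mean_excess (v n) m) (a := \oo)).
    exact: cvg_mean_excess.
  by apply: nearW => n; case: (vA n).
- move=> w wS; have [m mle] : exists m, (mean_excess w m <= 0)%E; last by exists m.
  apply/existsP; apply: contraT => /existsPn none.
  have : 0 < \sum_m fine (mean_excess w m); last by rewrite sum_fine_mean_excess// ltxx.
  rewrite (bigD1 (Ordinal M_gt0))//=; apply: ltr_pwDl.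
    by rewrite fine_gt0// ltNge none/= -ge0_fin_numE ?mean_excess_fin// ltW// ltNge none.
  by apply: sumr_ge0 => m _; rewrite fine_ge0// ltW// ltNge none.
- by move=> m w wS wm; split=> //; rewrite ltW// mean_excess_lt0.
(* Nonpositive numbers with sum 0 all vanish; a zero weight would then contradict
   [mean_excess_lt0]. *)
have eq0 m : mean_excess w m = 0%E.
  have e0 : fine (mean_excess w m) = 0.
    apply/eqP; rewrite -oppr_eq0; apply/eqP; move: m (erefl true).
    apply: (psumr_eq0P (P := xpredT) (F := fun m => - fine (mean_excess w m))) => [m _|].
      by rewrite oppr_ge0 fine_le0//; case: (w_le0 m).
    by rewrite sumrN sum_fine_mean_excess// oppr0.
  by rewrite -(fineK (mean_excess_fin m wS)) e0.
exists w; split=> // m; rewrite lt_neqAle wS.1 andbT; apply/eqP => wm.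
by have := mean_excess_lt0 wS (esym wm); rewrite eq0 ltxx.
Qed.

(** * Optimality of the Pareto shares under the budget constraints *)

Section Equilibrium.
Context (w : 'I_M -> R).
Hypotheses (wS : simplex w) (w_gt0 : forall m, 0 < w m).

Lemma pareto_gt0 m s : regular s -> 0 < pareto w m s.
Proof.
move=> [L0 _]; have wX : 0 < w m * inv_price w s by rewrite mulr_gt0// inv_price_gt0.
by have [] := inv_marginal_gt0 (@u_diff s m) (@u_inada s m) wX.
Qed.

(** First-order condition of agent [m], whose budget multiplier is [(w m)^-1]. *)
Lemma marginal_pareto m s : regular s ->
  derive1 (u s m) (pareto w m s) = (w m)^-1 * price w s.
Proof.
move=> [L0 _]; have X0 := inv_price_gt0 wS L0.
have wX : 0 < w m * inv_price w s by rewrite mulr_gt0.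
have [_] := inv_marginal_gt0 (@u_diff s m) (@u_inada s m) wX.
rewrite -/(pareto w m s) => E; rewrite /price -invfM.
by apply: (mulIf (lt0r_neq0 wX)); rewrite E mulVf// gt_eqF.
Qed.

Lemma field_comp_paretoE m s : regular s ->
  field_comp (U m) (pareto w m) s = (u s m (pareto w m s))%:E.
Proof. by move=> sreg; rewrite /field_comp UE// pareto_gt0. Qed.

Lemma utility_pareto_lt m s y : regular s -> 0 <= y -> y != pareto w m s ->
  (U m y s <
   (u s m (pareto w m s) + (w m)^-1 * price w s * (y - pareto w m s))%:E)%E.
Proof.
move=> sreg y0 yp; rewrite -(marginal_pareto m sreg).
exact: (utility_tangent_lt (v := U m ^~ s) (@U_fin s m) (@u_inc s m) (@u_conc s m)
  (@u_diff s m) (@U_cvg0 s m) (pareto_gt0 m sreg) y0 yp).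
Qed.

Lemma utility_pareto_le m s y : regular s -> 0 <= y ->
  (U m y s <=
   (u s m (pareto w m s) + (w m)^-1 * price w s * (y - pareto w m s))%:E)%E.
Proof.
move=> sreg y0; have [->|yp] := eqVneq y (pareto w m s).
  by rewrite subrr mulr0 addr0 UE// pareto_gt0.
by rewrite ltW// utility_pareto_lt.
Qed.

Lemma L0_plus_pareto m : L0_plus (pareto w m).
Proof. by split=> [|s]; [exact: measurable_pareto|exact: pareto_ge0]. Qed.

(** Monotonicity bounds the utility of the share by that of [Lambda] from above; the tangent at the
    share, evaluated at [Lambda], bounds it from below up to [price w s * Lambda s / w m]. *)
Lemma integrable_utility_pareto m : mu.-integrable setT (field_comp (U m) (pareto w m)).
Proof.
have iL : mu.-integrable setT (field_comp (U m) (fun s => 1 * Lambda s)).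
  exact: integrable_scale.
apply: (@ae_le_integrable _ _ _ _ _ (fun s =>
  `|field_comp (U m) (fun s => 1 * Lambda s)%R s| +
  ((w m)^-1)%:E * (price w s * Lambda s)%:E)%E).
- exact: (measurable_field_comp (U_field m) (U_utility m) (L0_plus_pareto m)).
- apply: integrableD => //; first exact: integrable_abse.
  by apply: integrableZl => //; exact: integrable_price_Lambda.
apply: filterS ae_regular => s sreg; have [L0 _] := sreg.
rewrite field_comp_paretoE// /field_comp mul1r UE//.
have L0' := Lambda_ge0 s.
have := utility_pareto_le m sreg L0'; rewrite UE// lee_fin => lo.
have up := utility_le (v := U m ^~ s) (@U_fin s m) (@u_inc s m) (@U_cvg0 s m)
  (pareto_ge0 w m s) (pareto_le m s wS).
rewrite UE ?pareto_gt0// UE// lee_fin in up.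
rewrite /= -EFinM -EFinD lee_fin.
have wp0 : 0 <= (w m)^-1 * price w s by rewrite mulr_ge0 ?price_ge0// invr_ge0 ltW.
have wpp : 0 <= (w m)^-1 * price w s * pareto w m s by rewrite mulr_ge0 ?pareto_ge0.
rewrite mulrBr in lo; rewrite mulrA.
have wpL : 0 <= (w m)^-1 * price w s * Lambda s by rewrite mulr_ge0.
have := ler_norm (u s m (Lambda s)); have := ler_norm (- u s m (Lambda s)).
rewrite normrN ler_norml => n1 n2; apply/andP; split; lra.
Qed.

Hypothesis w_eq0 : forall m, mean_excess w m = 0%E.

(** The tangent to the utility at the Pareto share. Splitting the increment into two net trades
    gives integrable terms, each of integral 0. *)
Definition supporting m (a : S -> R) s : \bar R :=
  (field_comp (U m) (pareto w m) s +
   ((w m)^-1)%:E * ((price w s * (a s - alpha0 m s))%:E - (excess w m s)%:E))%E.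

Lemma supportingE m a s : regular s -> supporting m a s =
  (u s m (pareto w m s) + (w m)^-1 * price w s * (a s - pareto w m s))%:E.
Proof.
move=> sreg; rewrite /supporting field_comp_paretoE// -EFinB -EFinM -EFinD.
by congr EFin; rewrite /excess; ring.
Qed.

(** Under the convention [+oo - +oo = -oo], a budget integral equal to 0 already forces
    integrability. *)
Lemma integrable_budget m a : budget_feasible mu (price w) (alpha0 m) a ->
  mu.-integrable setT (fun s => (price w s * (a s - alpha0 m s))%:E).
Proof.
move=> [[ma a0] int0]; apply: integrable_of_fin; last by rewrite int0.
apply: measurableT_comp => //; apply: measurable_funM; first exact: measurable_price.
by apply: measurable_funB => //; have [/(_ m)[]] := alpha0_alloc.
Qed.

Lemma integrable_supporting m a : budget_feasible mu (price w) (alpha0 m) a ->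
  mu.-integrable setT (supporting m a).
Proof.
move=> fa; apply: integrableD => //; first exact: integrable_utility_pareto.
apply: integrableZl => //; apply: integrableB => //; first exact: integrable_budget.
exact: integrable_excess.
Qed.

Lemma integral_supporting m a : budget_feasible mu (price w) (alpha0 m) a ->
  (\int[mu]_s supporting m a s = \int[mu]_s field_comp (U m) (pareto w m) s)%E.
Proof.
move=> fa; have [_ int0] := fa; have ia := integrable_budget fa.
have ie := integrable_excess m wS.
have iB := integrableB measurableT ia ie.
rewrite /supporting integralD//; [|exact: integrable_utility_pareto|exact: integrableZl].
rewrite integralZl// integralB// int0.
by rewrite -[X in (0 - X)%E]/(mean_excess w m) w_eq0 sube0 mule0 adde0.
Qed.

Lemma utility_le_supporting m a s : regular s -> 0 <= a s ->
  (field_comp (U m) a s <= supporting m a s)%E.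
Proof. by move=> sreg as0; rewrite supportingE// utility_pareto_le. Qed.

(** The tangent dominates the utility of [a] and has the same integral as the utility of the Pareto
    share. Equal integrals force almost everywhere equality, hence [a = pareto w m] by strictness of
    the tangent inequality. *)
Lemma pareto_maximizer m : the_maximizer mu (U m) (price w) (alpha0 m) (pareto w m).
Proof.
have ae_le a : budget_feasible mu (price w) (alpha0 m) a ->
    {ae mu, forall s, (field_comp (U m) a s <= supporting m a s)%E}.
  move=> [[_ a0] _]; apply: filterS ae_regular => s sreg.
  exact: utility_le_supporting.
have ma a : budget_feasible mu (price w) (alpha0 m) a ->
    measurable_fun setT (field_comp (U m) a).
  by move=> [La _]; exact: measurable_field_comp.
split.
(* The budget equation of the Pareto share is the vanishing of its mean excess. *)
- by split; [exact: L0_plus_pareto|exact: w_eq0].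
- move=> a fa; rewrite -(integral_supporting fa).
  apply: ae_le_integral; [exact: ma| |exact: ae_le].
  exact: measurable_int (integrable_supporting fa).
- move=> a fa; rewrite -(integral_supporting fa) => eq_int.
  have := ae_eq_of_integral_eq (ma _ fa) (integrable_supporting fa) (ae_le _ fa) eq_int.
  apply: filterS2 ae_regular => s sreg; rewrite supportingE// => Ua.
  have [[_ a0] _] := fa.
  apply/eqP; apply: contraT => /(utility_pareto_lt sreg (a0 s)).
  by rewrite -Ua ltxx.
Qed.

Lemma pareto_equilibrium :
  arrow_debreu_equilibrium mu U Lambda alpha0 (price w) (pareto w).
Proof.
split.
- split; first exact: measurable_price.
  by apply: filterS Lambda_gt0 => s L0; rewrite invr_gt0 inv_price_gt0.
- split; first exact: L0_plus_pareto.
  by apply: aeW => s; exact: sum_pareto.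
- have := integrable_fin_num measurableT (integrable_price_Lambda wS).
  by rewrite fin_numElt => /andP[].
- move=> m; split; last exact: pareto_maximizer.
  by have /integrableP[] := integrable_utility_pareto m.
Qed.

End Equilibrium.
End Economy.

Theorem corollary1 (R : realType) (d : measure_display) (S : measurableType d)
    (mu : {sigma_finite_measure set S -> \bar R})
    (M : nat) (M_gt0 : (0 < M)%N)
    (U : 'I_M -> R -> S -> \bar R)
    (U_field : forall m, measurable_field (U m))
    (U_utility : forall m, utility_assumption (U m))
    (Lambda : S -> R) (Lambda_L0 : L0_plus Lambda)
    (Lambda_gt0 : {ae mu, forall s, 0 < Lambda s})
    (alpha0 : 'I_M -> S -> R) (alpha0_alloc : allocation mu Lambda alpha0)
    (alpha0_neq0 : forall m, ~ {ae mu, forall s, alpha0 m s = 0})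
    (U_integrable : forall (t : R) (m : 'I_M), 0 < t -> t <= 1 ->
      (\int[mu]_s `|field_comp (U m) (fun s' => (t * Lambda s')%R) s| < +oo)%E) :
  exists (zeta : S -> R) (alpha1 : 'I_M -> S -> R),
    arrow_debreu_equilibrium mu U Lambda alpha0 zeta alpha1.
Proof.
have [w [wS w_gt0 w_eq0]] := equilibrium_weights M_gt0 U_field U_utility Lambda_L0
  Lambda_gt0 alpha0_alloc alpha0_neq0 U_integrable.
by exists (price U Lambda w), (pareto U Lambda w); exact: pareto_equilibrium.
Qed.
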